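(* Let $\phi\colon A\to B$ be a radical-preserving ring homomorphism with superfluous kernel. (i) If $A$ is left noetherian and semiperfect, then $\mathsf{fin.dim}\,A\le \mathsf{fin.dim}\,B+\mathsf{fd}\,B_A$. (ii) If $A$ is left perfect and $J(B)$ is a left T-nilpotent ideal of $B$, then $\mathsf{Fin.dim}\,A\le \mathsf{Fin.dim}\,B+\mathsf{fd}\,B_A$. In both cases, it holds that $\mathsf{gl.dim}\,A\le \mathsf{gl.dim}\,B+\mathsf{fd}\,B_A$.
   Context: Rings are associative with unit, and homomorphisms are unital. $J(R)$ is the Jacobson radical of $R$. A ring homomorphism $\phi\colon A\to B$ is radical-preserving if $\phi(J(A))\subseteq J(B)$; its kernel is called superfluous if $\mathrm{Ker}\,\phi\subseteq J(A)$. $\mathsf{fd}\,B_A$ is the flat dimension of $B$ as a right $A$-module via restriction of scalars along $\phi$ (possibly $\infty$). A ring $R$ is semiperfect if $R/J(R)$ is semisimple and idempotents lift modulo $J(R)$. A subset $T\subseteq R$ is left T-nilpotent if for every sequence $(a_i)_{i\in\mathbb N}$ in $T$ there is a positive integer $n$ with $a_1a_2\cdots a_n=0$. $R$ is left perfect if $R/J(R)$ is semisimple and $J(R)$ is left T-nilpotent (equivalently, every left $R$-module has a projective cover). $\mathsf{fin.dim}\,R$ (resp. $\mathsf{Fin.dim}\,R$) is the supremum of the projective dimensions of finitely generated (resp. all) left $R$-modules of finite projective dimension; $\mathsf{gl.dim}\,R$ is the left global dimension. *)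

(* Defs.v *)
From HB Require Import structures.
From mathcomp Require Import all_boot all_order all_algebra.
From mathcomp Require Import generic_quotient ring_quotient.
From mathcomp Require Import freeg.
From mathcomp Require Import boolp classical_sets constructive_ereal.

Set Implicit Arguments.
Unset Strict Implicit.
Unset Printing Implicit Defensive.

Import Order.TTheory GRing.Theory Num.Theory.
Local Open Scope classical_set_scope.
Local Open Scope ring_scope.
Local Open Scope quotient_scope.

(* Rings are [pzRingType]s, so the zero ring is allowed.  Left R-modules are
   [lmodType R]; right R-modules are [lmodType R^c], the scalar product
   [(r : R^c) *: m] standing for [m . r]. *)

Section Ideals.
Variable R : pzRingType.

Definition submodule (M : lmodType R) (U : set M) : Prop :=
  U 0 /\ forall (a : R) (x y : M), U x -> U y -> U (a *: x + y).

Definition left_ideal (I : set R) : Prop := submodule (I : set R^o).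

Definition maximal_left_ideal (m : set R) : Prop :=
  [/\ left_ideal m, m <> setT &
      forall L : set R, left_ideal L -> m `<=` L -> L = m \/ L = setT].

Definition jacobson : set R :=
  [set x | forall m : set R, maximal_left_ideal m -> m x].

Definition left_noetherian : Prop :=
  forall I : nat -> set R,
    (forall n, left_ideal (I n)) -> (forall n, I n `<=` I n.+1) ->
    exists N : nat, forall n : nat, (N <= n)%N -> I n = I N.

Definition left_T_nilpotent (T : set R) : Prop :=
  forall a : nat -> R, (forall i, T (a i)) ->
    exists n : nat, (0 < n)%N /\ \prod_(0 <= i < n) a i = 0.

Definition semisimple_module (M : lmodType R) : Prop :=
  forall U : set M, submodule U ->
    exists V : set M, [/\ submodule V, U `&` V = [set 0] &
      forall x : M, exists u v : M, [/\ U u, V v & x = u + v]].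

Definition semisimple_ring : Prop := semisimple_module R^o.

End Ideals.

Section JacobsonQuotient.
Variable R : pzRingType.

Lemma left_idealD (I : set R) x y : left_ideal I -> I x -> I y -> I (x + y).
Proof. by case=> _ h Ix Iy; have := h 1 x y Ix Iy; rewrite scale1r. Qed.

Lemma left_idealM (I : set R) a x : left_ideal I -> I x -> I (a * x).
Proof. by case=> h0 h Ix; have := h a x 0 Ix h0; rewrite addr0. Qed.

Lemma left_idealB (I : set R) x y : left_ideal I -> I x -> I y -> I (x - y).
Proof.
move=> hI Ix Iy; rewrite -mulN1r; apply: left_idealD => //.
exact: left_idealM.
Qed.

Lemma jacobson0 : jacobson (0 : R). Proof. by move=> m [[]]. Qed.

Lemma jacobsonB (x y : R) : jacobson x -> jacobson y -> jacobson (x - y).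
Proof.
move=> hx hy m hm; have [hL _ _] := hm.
by apply: left_idealB => //; [apply: hx | apply: hy].
Qed.

Lemma jacobsonMl (a x : R) : jacobson x -> jacobson (a * x).
Proof.
by move=> hx m hm; have [hL _ _] := hm; apply: left_idealM => //; apply: hx.
Qed.

Lemma jacobsonMr (x r : R) : jacobson x -> jacobson (x * r).
Proof.
move=> hx m hm; have [hL mT mmax] := hm.
have [mr|mNr] := pselect (m r); first exact: left_idealM.
pose L := [set y : R | m (y * r)].
have hLL : left_ideal L.
  split=> [|a y z hy hz]; first by rewrite /L /= mul0r; case: hL.
  by rewrite /L /= mulrDl -mulrA; apply: left_idealD => //; apply: left_idealM.
suff hmaxL : maximal_left_ideal L by exact: hx hmaxL.
split=> // [LT|L' hL' LL'].
  by apply: mNr; have : L 1 by [rewrite LT]; rewrite /L /= mul1r.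
have [L'L|/existsNP[y /not_implyP[L'y Ly]]] := pselect (L' `<=` L).
  by left; rewrite eqEsubset.
right; rewrite eqEsubset; split=> // z _.
pose K := [set w : R | exists a u, m u /\ w = u + a * (y * r)].
have hK : left_ideal K.
  split; first by exists 0, 0; rewrite mul0r addr0; case: hL.
  move=> c _ _ [a [u [mu ->]]] [b [v [mv ->]]].
  exists (c * a + b), (c * u + v); split.
    by apply: left_idealD => //; apply: left_idealM.
  rewrite /GRing.scale /= mulrDr [(c * a + b) * _]mulrDl -[c * a * _]mulrA.
  by rewrite addrACA.
have mK : m `<=` K by move=> u mu; exists 0, u; rewrite mul0r addr0.
have [Km|KT] := mmax K hK mK.
  case: Ly; rewrite /L /= -Km; exists 1, 0; rewrite mul1r add0r.
  by case: hL.
have [a [u [mu zr]]] : K (z * r) by rewrite KT.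
rewrite -(subrK (a * y) z); apply: left_idealD => //; last exact: left_idealM.
by apply: LL'; rewrite /L /= mulrBl zr -mulrA addrK.
Qed.

Definition jacobson_pred : {pred R} := fun x => `[< jacobson x >].

Lemma jacobson_zmod_closed : zmod_closed jacobson_pred.
Proof.
split=> [|x y /asboolP hx /asboolP hy]; apply/asboolP; first exact: jacobson0.
exact: jacobsonB.
Qed.

HB.instance Definition _ :=
  GRing.isZmodClosed.Build R jacobson_pred jacobson_zmod_closed.

End JacobsonQuotient.

(* R / J(R); ring_quotient.v only makes quotients of commutative rings into
   rings, so the multiplication is added here. *)
Definition jquot (R : pzRingType) : Type := Quotient.quot (@jacobson_pred R).

Section JacobsonQuotientRing.
Variable R : pzRingType.

HB.instance Definition _ := GRing.Zmodule.on (jquot R).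

Definition jproj (x : R) : jquot R := \pi_(Quotient.quot (@jacobson_pred R)) x.

Definition jmul (x y : jquot R) : jquot R :=
  jproj (repr (x : Quotient.quot (@jacobson_pred R)) *
         repr (y : Quotient.quot (@jacobson_pred R))).

Lemma jproj_eq (x y : R) : jproj x = jproj y <-> jacobson (x - y).
Proof.
split=> [/eqP|h].
  by rewrite /jproj -Quotient.idealrBE => /asboolP.
by apply/eqP; rewrite /jproj -Quotient.idealrBE; apply/asboolP.
Qed.

Lemma jproj_surj (x : jquot R) : exists a : R, jproj a = x.
Proof. by exists (repr (x : Quotient.quot (@jacobson_pred R))); exact: reprK. Qed.

Lemma jprojD : {morph jproj : x y / x + y}.
Proof. by move=> x y; rewrite /jproj raddfD. Qed.

Lemma jprojM (x y : R) : jmul (jproj x) (jproj y) = jproj (x * y).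
Proof.
apply/jproj_eq; set x' := repr _; set y' := repr _.
have hx : jacobson (x' - x) by apply/jproj_eq; exact: reprK.
have hy : jacobson (y' - y) by apply/jproj_eq; exact: reprK.
have -> : x' * y' - x * y = (x' - x) * y' - (- x * (y' - y)).
  by rewrite mulrBl mulNr mulrBr opprK addrA subrK.
by apply: jacobsonB; [exact: jacobsonMr | exact: jacobsonMl].
Qed.

Lemma jmulA : associative jmul.
Proof.
move=> x y z; have [a <-] := jproj_surj x; have [b <-] := jproj_surj y.
by have [c <-] := jproj_surj z; rewrite !jprojM mulrA.
Qed.

Lemma jmul1x : left_id (jproj 1) jmul.
Proof. by move=> x; have [a <-] := jproj_surj x; rewrite jprojM mul1r. Qed.

Lemma jmulx1 : right_id (jproj 1) jmul.
Proof. by move=> x; have [a <-] := jproj_surj x; rewrite jprojM mulr1. Qed.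

Lemma jmulDl : left_distributive jmul +%R.
Proof.
move=> x y z; have [a <-] := jproj_surj x; have [b <-] := jproj_surj y.
by have [c <-] := jproj_surj z; rewrite -jprojD !jprojM -jprojD mulrDl.
Qed.

Lemma jmulDr : right_distributive jmul +%R.
Proof.
move=> x y z; have [a <-] := jproj_surj x; have [b <-] := jproj_surj y.
by have [c <-] := jproj_surj z; rewrite -jprojD !jprojM -jprojD mulrDr.
Qed.

HB.instance Definition _ := GRing.Zmodule_isPzRing.Build (jquot R)
  jmulA jmul1x jmulx1 jmulDl jmulDr.

Definition idempotents_lift : Prop :=
  forall x : jquot R, x * x = x -> exists e : R, e * e = e /\ jproj e = x.

Definition semiperfect : Prop :=
  semisimple_ring (jquot R) /\ idempotents_lift.

Definition left_perfect : Prop :=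
  semisimple_ring (jquot R) /\ left_T_nilpotent (@jacobson R).

End JacobsonQuotientRing.

(* The tensor product of a right and a left module: the free abelian group on
   M * N modulo the subgroup generated by the bilinearity relations. *)
Section Tensor.
Variables (R : pzRingType) (M : lmodType R^c) (N : lmodType R).

Local Notation F := {freeg (M * N) / int}.

Inductive tensor_rel : F -> Prop :=
| Tensor_addl (m m' : M) (n : N) :
    tensor_rel (<<(m + m', n)>> - <<(m, n)>> - <<(m', n)>>)
| Tensor_addr (m : M) (n n' : N) :
    tensor_rel (<<(m, n + n')>> - <<(m, n)>> - <<(m, n')>>)
| Tensor_balanced (m : M) (r : R) (n : N) :
    tensor_rel (<<((r : R^c) *: m, n)>> - <<(m, r *: n)>>)
| Tensor_zero : tensor_rel 0
| Tensor_sub (x y : F) : tensor_rel x -> tensor_rel y -> tensor_rel (x - y).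

Definition tensor_pred : {pred F} := fun x => `[< tensor_rel x >].

Lemma tensor_zmod_closed : zmod_closed tensor_pred.
Proof.
split=> [|x y /asboolP hx /asboolP hy]; apply/asboolP.
  exact: Tensor_zero.
exact: Tensor_sub.
Qed.

HB.instance Definition _ :=
  GRing.isZmodClosed.Build F tensor_pred tensor_zmod_closed.

Definition tensor : zmodType := Quotient.quot tensor_pred.

Definition tensor_proj (x : F) : tensor := \pi_(Quotient.quot tensor_pred) x.

Definition tens (m : M) (n : N) : tensor := tensor_proj <<(m, n)>>.

Lemma tensor_proj_eq (x y : F) :
  tensor_proj x = tensor_proj y <-> tensor_rel (x - y).
Proof.
split=> [/eqP|h].
  by rewrite /tensor_proj -Quotient.idealrBE => /asboolP.
by apply/eqP; rewrite /tensor_proj -Quotient.idealrBE; apply/asboolP.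
Qed.

Lemma tensor_projB : {morph tensor_proj : x y / x - y}.
Proof. by move=> x y; rewrite /tensor_proj raddfB. Qed.

Definition tensor_repr (x : tensor) : F := repr (x : Quotient.quot tensor_pred).

Lemma tensor_reprK (x : tensor) : tensor_proj (tensor_repr x) = x.
Proof. exact: reprK. Qed.

End Tensor.

Section TensorMap.
Variables (R : pzRingType) (M : lmodType R^c) (N N' : lmodType R).
Variable f : {linear N -> N'}.

Definition free_map : {freeg (M * N) / int} -> {freeg (M * N') / int} :=
  fglift (fun p => <<(p.1, f p.2)>>).

(* M (x) f, characterised by [tensor_map_tens] and [tensor_mapB]. *)
Definition tensor_map (x : tensor M N) : tensor M N' :=
  tensor_proj (free_map (tensor_repr x)).

Lemma free_mapU (p : M * N) : free_map <<p>> = <<(p.1, f p.2)>>.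
Proof. by rewrite /free_map liftU scale1r. Qed.

Lemma free_mapB : {morph free_map : x y / x - y}.
Proof. exact: lift_is_additive. Qed.

Lemma free_map_rel (x : {freeg (M * N) / int}) :
  tensor_rel x -> tensor_rel (free_map x).
Proof.
elim=> [m m' n|m n n'|m r n||{}x y _ hx _ hy].
- by rewrite !free_mapB !free_mapU; apply: Tensor_addl.
- by rewrite !free_mapB !free_mapU /= raddfD; apply: Tensor_addr.
- by rewrite !free_mapB !free_mapU /= linearZ; apply: Tensor_balanced.
- by rewrite -(subrr 0) free_mapB subrr; apply: Tensor_zero.
- by rewrite free_mapB; apply: Tensor_sub.
Qed.

Lemma tensor_map_proj (x : {freeg (M * N) / int}) :
  tensor_map (tensor_proj x) = tensor_proj (free_map x).
Proof.
apply/tensor_proj_eq; rewrite -free_mapB; apply: free_map_rel.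
exact/tensor_proj_eq/tensor_reprK.
Qed.

Lemma tensor_map_tens (m : M) (n : N) :
  tensor_map (tens m n) = tens m (f n).
Proof. by rewrite /tens tensor_map_proj free_mapU. Qed.

Lemma tensor_mapB : {morph tensor_map : x y / x - y}.
Proof.
move=> x y; rewrite -[x]tensor_reprK -[y]tensor_reprK -tensor_projB.
by rewrite !tensor_map_proj free_mapB tensor_projB.
Qed.

End TensorMap.

Section Modules.
Variable R : pzRingType.

Definition finitely_generated (M : lmodType R) : Prop :=
  exists s : seq M, forall x : M,
    exists c : nat -> R, x = \sum_(i < size s) c i *: s`_i.

Definition projective (P : lmodType R) : Prop :=
  forall (M N : lmodType R) (g : {linear M -> N}) (f : {linear P -> N}),
    (forall y : N, exists x : M, g x = y) ->
    exists h : {linear P -> M}, forall x : P, g (h x) = f x.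

Definition flat (M : lmodType R^c) : Prop :=
  forall (N N' : lmodType R) (f : {linear N -> N'}),
    injective f -> injective (tensor_map (M := M) f).

(* An exact sequence ... -> X 2 -> X 1 -> X 0 -> M -> 0. *)
Record resolution (M : lmodType R) := Resolution {
  res_obj :> nat -> lmodType R;
  res_diff : forall i : nat, {linear res_obj i.+1 -> res_obj i};
  res_aug : {linear res_obj 0 -> M};
  res_aug_surj : forall x : M, exists y, res_aug y = x;
  res_exact_aug : forall x, res_aug x = 0 <-> exists y, res_diff 0 y = x;
  res_exact : forall i x, res_diff i x = 0 <-> exists y, res_diff i.+1 y = x
}.

Definition has_resolution (C : lmodType R -> Prop) (M : lmodType R) (n : nat) :
  Prop :=
  exists X : resolution M,
    (forall i : nat, C (X i)) /\
    (forall i : nat, (n < i)%N -> forall x : X i, x = 0).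

(* Dimensions live in [\bar int], the integers extended by -oo and +oo; only
   natural numbers and +oo occur as values.  The zero module has dimension 0. *)
Definition resolution_dim (C : lmodType R -> Prop) (M : lmodType R) :
  \bar int :=
  infimum +oo%E [set d | exists n : nat,
    has_resolution C M n /\ d = (n%:Z)%:E].

Definition proj_dim (M : lmodType R) : \bar int := resolution_dim projective M.

(* [fin_dim], [Fin_dim] and [gl_dim] quantify over left modules with a Prop
   existential instead of an image of a [set (lmodType R)], as the latter would
   constrain the universe of modules to lie strictly below that of [set]. *)
Definition fin_dim : \bar int :=
  supremum -oo%E [set d | exists M : lmodType R,
    [/\ finitely_generated M, (proj_dim M < +oo)%E & d = proj_dim M]].

Definition Fin_dim : \bar int :=
  supremum -oo%E [set d | exists M : lmodType R,
    (proj_dim M < +oo)%E /\ d = proj_dim M].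

Definition gl_dim : \bar int :=
  supremum -oo%E [set d | exists M : lmodType R, d = proj_dim M].

End Modules.

Definition flat_dim (R : pzRingType) (M : lmodType R^c) : \bar int :=
  resolution_dim (@flat R) M.

(* B as a right A-module along phi : A -> B, i.e. b . a = b * phi a. *)
Definition right_restriction (A B : pzRingType) (phi : {rmorphism A -> B}) :
  Type := B.

Section RightRestriction.
Variables (A B : pzRingType) (phi : {rmorphism A -> B}).

HB.instance Definition _ := GRing.Zmodule.on (right_restriction phi).

Definition right_restriction_scale (a : A^c) (b : right_restriction phi) :
  right_restriction phi := (b : B) * phi a.

Lemma right_restriction_scaleA (a a' : A^c) b :
  right_restriction_scale a (right_restriction_scale a' b) =
  right_restriction_scale (a * a') b.
Proof.
by rewrite /right_restriction_scale -mulrA -(rmorphM phi (a' : A) (a : A)).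
Qed.

Lemma right_restriction_scale1 : left_id 1 right_restriction_scale.
Proof. by move=> b; rewrite /right_restriction_scale (rmorph1 phi) mulr1. Qed.

Lemma right_restriction_scaleDr :
  right_distributive right_restriction_scale +%R.
Proof. by move=> a b b'; rewrite /right_restriction_scale -mulrDl. Qed.

Lemma right_restriction_scaleDl (b : right_restriction phi) :
  {morph right_restriction_scale^~ b : a a' / a + a'}.
Proof.
by move=> a a'; rewrite /right_restriction_scale (rmorphD phi) mulrDr.
Qed.

HB.instance Definition _ := GRing.Zmodule_isLmodule.Build A^c
  (right_restriction phi) right_restriction_scaleA right_restriction_scale1
  right_restriction_scaleDr right_restriction_scaleDl.

Definition radical_preserving : Prop := phi @` @jacobson A `<=` @jacobson B.

Definition superfluous_kernel : Prop :=
  [set a : A | phi a = 0] `<=` @jacobson A.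

End RightRestriction.

(* Main.v *)
(* Let d = fd B_A, and let P be a minimal projective resolution of an A-module M
   with syzygies K_n; it exists because finitely generated modules over a
   semiperfect ring, and all modules over a left perfect ring, have projective
   covers.  Since Tor_n^A(B, M) = 0 for n > d, tensoring with B keeps the
   sequences 0 -> K_(n+1) -> P_n -> K_n -> 0 exact for n >= d, so B (x) P, cut
   off at d, is a projective resolution of N = B (x) K_d, again with boundaries
   in the radical as phi preserves radicals.  If pd N <= b, then B (x) K_(d+b)
   is projective, B (x) K_(d+b+1) is a direct summand of B (x) P_(d+b) lying in
   its radical, and it vanishes by Nakayama's lemma (for finitely generated
   modules, or by T-nilpotence).  Another application of Nakayama gives
   B (x) P_(d+b+1) = 0, and the dual basis lemma turns this into
   P_(d+b+1) = J(A) P_(d+b+1), as Ker phi lies in J(A).  Hence K_(d+b+1) = 0 and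
   pd M <= b + d.  In the noetherian case the global dimension is controlled by
   finitely generated modules through Auslander's theorem. *)
Require Import Defs.
From HB Require Import structures.
From mathcomp Require Import all_boot all_order all_algebra.
From mathcomp Require Import generic_quotient ring_quotient freeg.
From mathcomp Require Import boolp classical_sets functions constructive_ereal.

Set Implicit Arguments.
Unset Strict Implicit.
Unset Printing Implicit Defensive.

Import Order.TTheory GRing.Theory Num.Theory.
Local Open Scope classical_set_scope.
Local Open Scope ring_scope.
Local Open Scope quotient_scope.

(** * Submodules, quotients and free modules *)

(** Below degree d the complex B (x) P may fail to be exact, so M itself is never compared with a
    B-module; passing to K_d is what costs the summand d. No Tor group is formed: all that is used
    of its vanishing is that B (x) K_(n+1) -> B (x) P_n is injective, and this is proved by
    induction along a flat resolution of B. For the finitistic bounds, pd N must be known to be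
    finite before the dimension of B can bound it; this comes from pd M being finite. That B (x)
    K_(d+b+1) vanishes says nothing directly about K_(d+b+1), because coordinates, hence membership
    in Ker phi, are only available on projective modules. This forces the detour through P_(d+b+1).
    Both cases are instances of one argument about a class of modules that have covers with kernels
    in the class and satisfy Nakayama's lemma. Covers need no orthogonal decomposition of 1:
    idempotents that are local modulo J and generate the ring modulo J suffice, and Zorn's lemma
    picks a maximal independent family. Auslander's theorem is proved without Ext, by extending
    partial lifts along a filtration with cyclic quotients. *)

Section Submodules.
Variables (R : pzRingType).
Implicit Types M N K P Q : lmodType R.

(** Many maps below arise from choice or from representatives, and only afterwards turn out to be
    linear; this bundles them. *)
Lemma linear_ex M N (f : M -> N) :
  linear f -> exists g : {linear M -> N}, forall x, g x = f x.
Proof.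
move=> hf; pose L := GRing.isLinear.Build R M N *:%R f hf.
by exists (HB.pack_for {linear M -> N} f L).
Qed.

Section Sub.
Variables (M : lmodType R) (U : set M) (hU : submodule U).

(** The proof is a dummy argument: with it in the term, the closure instance can be inferred. *)
Definition smod_pred (_ : submodule U) : {pred M} := fun x => `[< U x >].

Lemma smod_closed : submod_closed (smod_pred hU).
Proof.
split=> [|a x y /asboolP hx /asboolP hy]; apply/asboolP; first by case: hU.
exact: hU.2.
Qed.

HB.instance Definition _ :=
  GRing.isSubmodClosed.Build R M (smod_pred hU) smod_closed.

Record smod := Smod { smod_val : M; smod_valP : smod_val \in smod_pred hU }.

HB.instance Definition _ := [isSub for smod_val].
HB.instance Definition _ := [Choice of smod by <:].
HB.instance Definition _ := [SubChoice_isSubLmodule of smod by <:].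
End Sub.

(** Hides the subtype: from here on a submodule is mostly an abstract module with an injective
    map. *)
Lemma submodule_ex M (U : set M) : submodule U ->
  exists (K : lmodType R) (i : {linear K -> M}),
    injective i /\ forall x, U x <-> exists k, i k = x.
Proof.
move=> hU; exists (smod hU : lmodType R).
have [i hi] : exists i : {linear smod hU -> M}, forall x, i x = val x.
  by apply: linear_ex => a x y; rewrite linearP.
exists i; split=> [x y|x]; first by rewrite !hi; exact: val_inj.
split=> [Ux|[k <-]]; last by rewrite hi; apply/asboolP; exact: (smod_valP k).
by exists (Smod (asboolT Ux : x \in smod_pred hU)); rewrite hi.
Qed.

Section Quot.
Variables (M : lmodType R) (U : set M) (hU : submodule U).

Definition qmod : Type := Quotient.quot (smod_pred hU).
HB.instance Definition _ := GRing.Zmodule.on qmod.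

Definition qproj (x : M) : qmod := \pi_(Quotient.quot (smod_pred hU)) x.

Lemma qproj_eq x y : qproj x = qproj y <-> U (x - y).
Proof.
split=> [/eqP|h].
  by rewrite /qproj -Quotient.idealrBE => /asboolP.
by apply/eqP; rewrite /qproj -Quotient.idealrBE; apply/asboolP.
Qed.

Lemma qproj_surj (x : qmod) : exists a : M, qproj a = x.
Proof. by exists (repr (x : Quotient.quot (smod_pred hU))); exact: reprK. Qed.

Lemma qprojD : {morph qproj : x y / x + y}.
Proof. by move=> x y; rewrite /qproj raddfD. Qed.

Definition qscale (a : R) (x : qmod) : qmod :=
  qproj (a *: repr (x : Quotient.quot (smod_pred hU))).

Lemma qprojZ a x : qscale a (qproj x) = qproj (a *: x).
Proof.
apply/qproj_eq; rewrite -scalerBr -[_ *: _]addr0.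
by apply: hU.2; [apply/qproj_eq; exact: reprK | case: hU].
Qed.

Lemma qscaleA a b x : qscale a (qscale b x) = qscale (a * b) x.
Proof. by have [y <-] := qproj_surj x; rewrite !qprojZ scalerA. Qed.

Lemma qscale1 : left_id 1 qscale.
Proof. by move=> x; have [y <-] := qproj_surj x; rewrite !qprojZ scale1r. Qed.

Lemma qscaleDr : right_distributive qscale +%R.
Proof.
move=> a x y; have [{}x <-] := qproj_surj x; have [{}y <-] := qproj_surj y.
by rewrite -qprojD !qprojZ -qprojD scalerDr.
Qed.

Lemma qscaleDl x : {morph qscale^~ x : a b / a + b}.
Proof.
by move=> a b; have [{}x <-] := qproj_surj x; rewrite !qprojZ -qprojD scalerDl.
Qed.

HB.instance Definition _ := GRing.Zmodule_isLmodule.Build R qmod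
  qscaleA qscale1 qscaleDr qscaleDl.
End Quot.

Lemma quotient_ex M (U : set M) : submodule U ->
  exists (Q : lmodType R) (p : {linear M -> Q}),
    (forall y, exists x, p x = y) /\ forall x, p x = 0 <-> U x.
Proof.
move=> hU; exists (qmod hU : lmodType R).
have [p hp] : exists p : {linear M -> qmod hU}, forall x, p x = qproj hU x.
  by apply: linear_ex => a x y; rewrite qprojD -qprojZ.
exists p; split=> [y|x].
  by have [x <-] := qproj_surj y; exists x.
by rewrite -[X in _ = X](linear0 p) !hp qproj_eq subr0.
Qed.

(** Preimages under [i] are unique, so any choice of them is linear. *)
Lemma factor_inj K M N (i : {linear K -> M}) (f : {linear N -> M}) :
  injective i -> (forall n, exists k, i k = f n) ->
  exists g : {linear N -> K}, forall n, i (g n) = f n.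
Proof.
move=> inj_i /choice[g hg].
have [g' hg'] : exists g' : {linear N -> K}, forall x, g' x = g x.
  by apply: linear_ex => a x y; apply: inj_i; rewrite linearP !hg linearP.
by exists g' => n; rewrite hg'.
Qed.

Lemma submodule_lin M (U : set M) : submodule U ->
  [/\ U 0, forall x y, U x -> U y -> U (x + y),
     forall a x, U x -> U (a *: x) & forall x y, U x -> U y -> U (x - y)].
Proof.
case=> h0 h; split=> // [x y hx hy|a x hx|x y hx hy].
- by rewrite -[x]scale1r; apply: h.
- by rewrite -[_ *: _]addr0; apply: h.
- by rewrite addrC -scaleN1r; apply: h.
Qed.

Lemma submodule_sum M (U : set M) (I : eqType) (s : seq I) (F : I -> M) :
  submodule U -> (forall i, i \in s -> U (F i)) -> U (\sum_(i <- s) F i).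
Proof.
move=> /submodule_lin[h0 hD _ _] hF; rewrite big_seq.
by apply: big_ind => // i; apply: hF.
Qed.

Lemma submodule_set0 M : submodule [set 0 : M].
Proof. by split=> // a x y /= -> ->; rewrite scaler0 addr0. Qed.

Lemma submodule_ker M N (f : {linear M -> N}) : submodule [set x | f x = 0].
Proof.
split=> [|a x y /= hx hy]; first by rewrite /= linear0.
by rewrite linearP hx hy scaler0 addr0.
Qed.

Lemma kernel_ex M N (f : {linear M -> N}) :
  exists (K : lmodType R) (i : {linear K -> M}),
    injective i /\ forall x, f x = 0 <-> exists k, i k = x.
Proof. exact: submodule_ex (submodule_ker f). Qed.

End Submodules.

(** * Free modules as finitely supported functions *)

Section Free.
Variables (R : pzRingType) (T : choiceType).

Definition supp_in (z : T -> R) (s : seq T) :=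
  uniq s /\ forall t, t \notin s -> z t = 0.

Definition fsupp_fun (z : T -> R) : Prop := exists s, supp_in z s.

Lemma big_supp (V : zmodType) (F : T -> V) (s s' : seq T) :
  uniq s -> uniq s' -> (forall t, t \notin s -> F t = 0) ->
  (forall t, t \notin s' -> F t = 0) ->
  \sum_(t <- s) F t = \sum_(t <- s') F t.
Proof.
move=> us us' hs hs'.
rewrite (bigID (mem s')) /= [X in _ + X]big1 => [|t /hs'//].
rewrite [RHS](bigID (mem s)) /= [X in _ = _ + X]big1 => [|t /hs//].
rewrite !addr0 -big_filter -[RHS]big_filter; apply: perm_big; apply: uniq_perm.
- exact: filter_uniq.
- exact: filter_uniq.
- by move=> t; rewrite !mem_filter andbC.
Qed.

(** Some duplicate-free list containing the support, with default [[::]]; by [lincombE] the choice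
    does not affect linear combinations. *)
Definition fsupp (z : T -> R) : seq T :=
  if pselect (fsupp_fun z) is left h then sval (cid h) else [::].

Lemma fsuppP z : fsupp_fun z -> supp_in z (fsupp z).
Proof. by move=> h; rewrite /fsupp; case: pselect => // h'; case: cid. Qed.

Definition lincomb (M : lmodType R) (x : T -> M) (z : T -> R) : M :=
  \sum_(t <- fsupp z) z t *: x t.

Lemma lincombE (M : lmodType R) (x : T -> M) z s :
  supp_in z s -> lincomb x z = \sum_(t <- s) z t *: x t.
Proof.
move=> hs; have hz : fsupp_fun z by exists s.
have [u1 h1] := fsuppP hz; case: hs => u2 h2.
apply: big_supp => // t; first by move=> /h1->; rewrite scale0r.
by move=> /h2->; rewrite scale0r.
Qed.

Lemma supp_in_common (z w : T -> R) : fsupp_fun z -> fsupp_fun w ->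
  exists s, supp_in z s /\ supp_in w s.
Proof.
case=> s [us hs] [s' [us' hs']]; exists (undup (s ++ s')).
by split; split=> [|t]; rewrite ?undup_uniq // mem_undup mem_cat => /norP[? ?];
  [apply: hs | apply: hs'].
Qed.

Lemma submodule_fsupp : submodule (fsupp_fun : set (T -> R^o)).
Proof.
split=> [|a z w hz hw]; first by exists [::].
have [s [[us hz'] [_ hw']]] := supp_in_common hz hw.
exists s; split=> // t ht.
have -> : (a *: z + w) t = a * z t + w t by [].
by rewrite hz' // hw' // mulr0 addr0.
Qed.

Definition free_mod : Type := smod submodule_fsupp.
HB.instance Definition _ := GRing.Lmodule.on free_mod.
Definition fcoef (z : free_mod) : T -> R := smod_val z.

Lemma fcoefP z : fsupp_fun (fcoef z).
Proof. by apply/asboolP; exact: (smod_valP z). Qed.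

Lemma fcoef_inj z w : fcoef z =1 fcoef w -> z = w.
Proof. by move=> h; apply/val_inj/funext. Qed.

Lemma fcoefD z w t : fcoef (z + w) t = fcoef z t + fcoef w t.
Proof. by []. Qed.

Lemma fcoefZ a z t : fcoef (a *: z) t = a * fcoef z t.
Proof. by []. Qed.

Lemma fcoefB z w t : fcoef (z - w) t = fcoef z t - fcoef w t.
Proof. by []. Qed.

Lemma fcoef0 t : fcoef 0 t = 0.
Proof. by []. Qed.

Lemma free_mod_ex (f : T -> R) : fsupp_fun f ->
  exists z : free_mod, forall t, fcoef z t = f t.
Proof. by move=> h; exists (Smod (asboolT h : f \in smod_pred submodule_fsupp)). Qed.

Definition fev (M : lmodType R) (x : T -> M) (z : free_mod) : M :=
  lincomb x (fcoef z).

Lemma fev_is_linear (M : lmodType R) (x : T -> M) : linear (fev x).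
Proof.
move=> a z w; have [s [hz hw]] := supp_in_common (fcoefP z) (fcoefP w).
rewrite /fev (lincombE _ hz) (lincombE _ hw) (@lincombE M x _ s).
  rewrite scaler_sumr -big_split; apply: eq_bigr => t _.
  by rewrite fcoefD fcoefZ scalerDl scalerA.
by split=> [|t ht]; [case: hz | rewrite fcoefD fcoefZ hz.2 // hw.2 // mulr0 addr0].
Qed.

HB.instance Definition _ (M : lmodType R) (x : T -> M) :=
  GRing.isLinear.Build R free_mod M *:%R (fev x) (@fev_is_linear M x).

Lemma fdelta_supp (t : T) (a : R) : supp_in (fun u => if u == t then a else 0) [:: t].
Proof. by split=> // u; rewrite inE => /negPf->. Qed.

Definition fdelta (t : T) (a : R) : free_mod :=
  sval (cid (free_mod_ex (ex_intro _ _ (fdelta_supp t a)))).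

Lemma fdeltaE t a u : fcoef (fdelta t a) u = if u == t then a else 0.
Proof. by rewrite /fdelta; case: cid. Qed.

Lemma fev_delta (M : lmodType R) (x : T -> M) t a : fev x (fdelta t a) = a *: x t.
Proof.
rewrite /fev (@lincombE M x _ [:: t]) ?big_seq1 ?fdeltaE ?eqxx //.
have [u h] := fdelta_supp t a.
by split=> // v /h; rewrite fdeltaE.
Qed.

Lemma free_sum z s : supp_in (fcoef z) s -> z = \sum_(t <- s) fdelta t (fcoef z t).
Proof.
case=> us hs; apply: fcoef_inj => u.
have -> : fcoef (\sum_(t <- s) fdelta t (fcoef z t)) u =
    \sum_(t <- s) fcoef (fdelta t (fcoef z t)) u.
  by elim/big_rec2: _ => [|t a b _ <-]; rewrite ?fcoef0 ?fcoefD.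
under eq_bigr do rewrite fdeltaE.
have [us'|ns] := boolP (u \in s); last first.
  rewrite hs // big_seq big1 // => t; case: eqP => // <- ; by rewrite (negPf ns).
rewrite (bigD1_seq u) //= eqxx big1 ?addr0 // => t.
by rewrite eq_sym => /negPf->.
Qed.

Lemma fdeltaZ a t b : a *: fdelta t b = fdelta t (a * b).
Proof.
by apply: fcoef_inj => u; rewrite fcoefZ !fdeltaE; case: eqP; rewrite ?mulr0.
Qed.

End Free.

(** * Short exact sequences and projective dimension *)

Section Projective.
Variable R : pzRingType.
Implicit Types M N K P Q W L X Y Z V : lmodType R.

Definition ses K P M (i : {linear K -> P}) (p : {linear P -> M}) : Prop :=
  [/\ injective i, forall y, exists x, p x = y &
      forall x, p x = 0 <-> exists k, i k = x].

Lemma ses_comp0 K P M (i : {linear K -> P}) (p : {linear P -> M}) k :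
  ses i p -> p (i k) = 0.
Proof. by case=> _ _ h; apply/h; exists k. Qed.

(** Projective dimension at most [n], unfolded one syzygy at a time so that inductions need no
    infinite complex; [pdle_has_resolution] links it to resolutions. *)
Fixpoint pdle (n : nat) M : Prop :=
  if n is m.+1 then
    exists K P (i : {linear K -> P}) (p : {linear P -> M}),
      [/\ ses i p, projective P & pdle m K]
  else projective M.

Lemma ses_kernel P M (p : {linear P -> M}) : (forall y, exists x, p x = y) ->
  exists K (i : {linear K -> P}), ses i p.
Proof. by have [K [i [ii hi]]] := kernel_ex p; exists K, i. Qed.

Lemma linear_injP M N (f : {linear M -> N}) :
  (forall x, f x = 0 -> x = 0) -> injective f.
Proof.
move=> h x y e; apply/eqP; rewrite -subr_eq0; apply/eqP/h.
by rewrite linearB e subrr.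
Qed.

Lemma projective_retract P M (s : {linear M -> P}) (r : {linear P -> M}) :
  (forall x, r (s x) = x) -> projective P -> projective M.
Proof.
move=> rs hP X Y g f sg; have [h hh] := hP _ _ g (f \o r) sg.
by exists (h \o s) => x /=; rewrite hh /= rs.
Qed.

Lemma ses_split K W Q (i : {linear K -> W}) (p : {linear W -> Q}) :
  ses i p -> projective Q ->
  exists (s : {linear Q -> W}) (r : {linear W -> K}),
    [/\ forall q, p (s q) = q, forall k, r (i k) = k &
        forall w, w = i (r w) + s (p w)].
Proof.
move=> [ii sp ex] hQ; have [s hs] := hQ _ _ p idfun sp.
have [|r hr] := @factor_inj _ _ _ _ i (idfun \- (s \o p)) ii.
  by move=> w; apply/ex; rewrite linearB /= hs subrr.
exists s, r; split=> // [k|w]; last by rewrite hr /= subrK.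
apply: ii; rewrite hr /=.
by have -> : p (i k) = 0; [apply/ex; exists k | rewrite linear0 subr0].
Qed.

Lemma ses_projective K W Q (i : {linear K -> W}) (p : {linear W -> Q}) :
  ses i p -> projective Q -> projective K -> projective W.
Proof.
move=> S hQ hK X Y g f sg; have [s [r [ps ri wE]]] := ses_split S hQ.
have [h1 hh1] := hK _ _ g (f \o i) sg.
have [h2 hh2] := hQ _ _ g (f \o s) sg.
exists ((h1 \o r) \+ (h2 \o p)) => w.
by rewrite linearD /= hh1 hh2 /= -linearD -wE.
Qed.

Lemma pair_linear_ex M P Q (f : {linear M -> P}) (g : {linear M -> Q}) :
  exists h : {linear M -> (P * Q)%type}, forall x, h x = (f x, g x).
Proof. by apply: linear_ex => a x y; rewrite !linearP. Qed.

Lemma ses_prod P Q : exists (i : {linear P -> (P * Q)%type})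
    (p : {linear (P * Q)%type -> Q}), ses i p.
Proof.
have [i hi] := pair_linear_ex (@idfun P : {linear P -> P}) (\0 : {linear P -> Q}).
exists i, snd; split=> [x y|y|[x y]]; first by rewrite !hi => -[].
  by exists (0, y).
split=> [/= ->|[z]]; first by exists x; rewrite hi.
by rewrite hi => -[_ <-].
Qed.

Lemma projective_prod P Q : projective P -> projective Q ->
  projective (P * Q)%type.
Proof.
have [i [p S]] := ses_prod P Q.
by move=> hP hQ; exact: ses_projective S hQ hP.
Qed.

(** The sequence splits, so [W] is [K] plus a projective summand. To pass from [K] to [W], add [Q]
    to the first term of the resolution; the converse removes it again. *)
Lemma ses_projective_pdle n K W Q (i : {linear K -> W}) (p : {linear W -> Q}) :
  ses i p -> projective Q -> pdle n K <-> pdle n W.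
Proof.
move=> S hQ; have [s [r [ps ri wE]]] := ses_split S hQ.
have pi0 k := ses_comp0 k S.
have [ii sp ex] := S.
split; case: n => [|n] /=; first exact: ses_projective S hQ.
- move=> [L [P [a [b [[ia sb exb] hP hL]]]]].
  have [a' ha'] := pair_linear_ex a (\0 : {linear L -> Q}).
  exists L, (P * Q)%type, a', ((i \o b \o fst) \+ (s \o snd)).
  split=> //; last exact: projective_prod.
  split=> [x y|w|[x q]]; first by rewrite !ha' => -[/ia].
    have [x hx] := sb (r w); exists (x, p w).
    by rewrite /= hx -wE.
  rewrite /=; split=> [h|[l]].
    have q0 : q = 0 by rewrite -[q]ps -[p _]add0r -(pi0 (b x)) -linearD h linear0.
    have : b x = 0 by apply: ii; rewrite linear0 -h q0 linear0 addr0.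
    by move=> /exb[l <-]; exists l; rewrite ha' q0.
  rewrite ha' => -[<- <-].
  have -> : b (a l) = 0 by apply/exb; exists l.
  by rewrite !linear0 addr0.
- by apply: projective_retract ri.
- move=> [L [P [a [b [[ia sb exb] hP hL]]]]].
  (* [P'] is the preimage of [K] in [P]: a summand of [P], as [Q] is projective, which covers [K]
     with the same kernel [L]. *)
  have [|P' [j S']] := @ses_kernel P Q (p \o b).
    by move=> y; have [w <-] := sp y; have [x <-] := sb w; exists x.
  have [s' [r' [_ r'j _]]] := ses_split S' hQ.
  have [ij sj exj] := S'.
  have hP' : projective P' by apply: projective_retract r'j hP.
  have [b' hb'] : exists b' : {linear P' -> K}, forall x, i (b' x) = (b \o j) x.
    by apply: factor_inj ii _ => x; apply/ex; rewrite -/((p \o b) (j x)); apply: (ses_comp0 x S').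
  have ba0 l : b (a l) = 0 by apply/exb; exists l.
  have [a' ha'] : exists a' : {linear L -> P'}, forall x, j (a' x) = a x.
    by apply: factor_inj ij _ => x; apply/exj; rewrite /= ba0 linear0.
  exists L, P', a', b'; split=> //; split=> [x y e|k|x].
  + by apply: ia; rewrite -!ha' e.
  + have [x hx] := sb (i k); have /exj[y hy] : (p \o b) x = 0 by rewrite /= hx pi0.
    by exists y; apply: ii; rewrite hb' /= hy.
  + split=> [h|[l <-]]; last by apply: ii; rewrite hb' /= ha' ba0 linear0.
    have /exb[l hl] : b (j x) = 0 by rewrite -[b _]hb' h linear0.
    by exists l; apply: ij; rewrite ha'.
Qed.

(** The pullback [W] of [p] and [p'], obtained as the kernel of [d], is an extension of [P'] by [K]
    and of [P] by [K']; both split. *)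
Lemma schanuel n K P K' P' M (i : {linear K -> P}) (p : {linear P -> M})
    (i' : {linear K' -> P'}) (p' : {linear P' -> M}) :
  ses i p -> ses i' p' -> projective P -> projective P' -> pdle n K -> pdle n K'.
Proof.
move=> S S' hP hP' hK; have [ii sp ex] := S; have [ii' sp' ex'] := S'.
pose d : {linear (P * P')%type -> M} := (p \o fst) \- (p' \o snd).
have hd x : d x = p x.1 - p' x.2 by [].
have [W [j [ij hj]]] := kernel_ex d.
have jE w : p (j w).1 = p' (j w).2.
  have /hj : exists k, j k = j w by exists w.
  by rewrite hd => /eqP; rewrite subr_eq0 => /eqP.
pose b : {linear W -> P'} := snd \o j.
pose b' : {linear W -> P} := fst \o j.
have hb w : b w = (j w).2 by [].
have hb' w : b' w = (j w).1 by [].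
have [a ha] : exists a : {linear K -> W}, forall k, j (a k) = (i k, 0).
  have [f hf] := pair_linear_ex i (\0 : {linear K -> P'}).
  have [|a ha] := @factor_inj _ _ _ _ j f ij; last by exists a => k; rewrite ha hf.
  by move=> k; apply/hj; rewrite hf hd /= (ses_comp0 k S) linear0 subr0.
have [a' ha'] : exists a' : {linear K' -> W}, forall k, j (a' k) = (0, i' k).
  have [f hf] := pair_linear_ex (\0 : {linear K' -> P}) i'.
  have [|a' ha'] := @factor_inj _ _ _ _ j f ij; last by exists a' => k; rewrite ha' hf.
  by move=> k; apply/hj; rewrite hf hd /= (ses_comp0 k S') linear0 subr0.
have S1 : ses a b.
  split=> [x y e|y|w].
  - by have := ha x; rewrite e ha => -[/ii].
  - have [x hx] := sp (p' y).
    have /hj[w hw] : d (x, y) = 0 by rewrite hd /= hx subrr.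
    by exists w; rewrite hb hw.
  - rewrite hb; split=> [h|[k <-]]; last by rewrite ha.
    have /ex[k hk] : p (j w).1 = 0 by rewrite jE h linear0.
    by exists k; apply: ij; rewrite ha hk -h; case: (j w).
have S2 : ses a' b'.
  split=> [x y e|y|w].
  - by have := ha' x; rewrite e ha' => -[/ii'].
  - have [x hx] := sp' (p y).
    have /hj[w hw] : d (y, x) = 0 by rewrite hd /= hx subrr.
    by exists w; rewrite hb' hw.
  - rewrite hb'; split=> [h|[k <-]]; last by rewrite ha'.
    have /ex'[k hk] : p' (j w).2 = 0 by rewrite -jE h linear0.
    by exists k; apply: ij; rewrite ha' hk -h; case: (j w).
apply/(ses_projective_pdle n S2 hP).
by apply/(ses_projective_pdle n S1 hP').
Qed.

(** The truncated predecessor is right at [n = 0]: then [K] is a summand of [P], hence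
    projective. *)
Lemma pdle_syzygy n K P M (i : {linear K -> P}) (p : {linear P -> M}) :
  ses i p -> projective P -> pdle n M -> pdle n.-1 K.
Proof.
move=> S hP; case: n => [|n] /= => [hM|[L [P' [i' [p' [S' hP' hL]]]]]].
  by have [s [r [_ ri _]]] := ses_split S hM; apply: projective_retract ri hP.
exact: schanuel S' S hP' hP hL.
Qed.

Lemma pdle_iso n M N (f : {linear M -> N}) : injective f ->
  (forall y, exists x, f x = y) -> pdle n M -> pdle n N.
Proof.
move=> fi fs; have [g hg] := @factor_inj _ _ _ _ f idfun fi fs.
have gK x : g (f x) = x by apply: fi; rewrite hg.
case: n => [|n] /=; first by apply: projective_retract hg.
move=> [K [P [i [p [[ii sp ex] hP hK]]]]].
exists K, P, i, (f \o p); split=> //; split=> // [y|x].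
  by have [z <-] := fs y; have [x <-] := sp z; exists x.
split=> [/= h|/ex /= ->]; last by rewrite linear0.
by apply/ex; rewrite -[p x]gK h linear0.
Qed.

Lemma zero_ses M : exists Z (i : {linear Z -> M}), ses i (@idfun M : {linear M -> M}).
Proof. by apply: ses_kernel => y; exists y. Qed.

Lemma projective_zero M : (forall x : M, x = 0) -> projective M.
Proof.
move=> h X Y g f sg; exists \0 => x /=.
by rewrite (h x) !linear0.
Qed.

Section FreeProjective.
Variables (T : choiceType) (e : T -> R).
Hypothesis he : forall t, e t * e t = e t.

(** The direct sum of the left ideals [R e_t]. The value 1 keeps the whole coordinate and the value
    0 removes it. *)
Definition idem_free : set (free_mod R T) := [set z | forall t, fcoef z t * e t = fcoef z t].

Lemma idem_free_submodule : submodule idem_free.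
Proof.
split=> [t|a z w hz hw t]; first by rewrite fcoef0 mul0r.
by rewrite fcoefD fcoefZ mulrDl -mulrA hz hw.
Qed.

Lemma idem_free_delta t a : idem_free (fdelta t (a * e t)).
Proof.
by move=> u; rewrite fdeltaE; case: eqP => [->|]; rewrite ?mul0r // -mulrA he.
Qed.

Lemma idem_free_sum z s : idem_free z -> supp_in (fcoef z) s ->
  z = \sum_(t <- s) fcoef z t *: fdelta t (e t).
Proof.
move=> hz hs; rewrite {1}(free_sum hs); apply: eq_bigr => t _.
by rewrite fdeltaZ hz.
Qed.

Lemma idem_free_projective V (j : {linear V -> free_mod R T}) : injective j ->
  (forall z, idem_free z <-> exists v, j v = z) -> projective V.
Proof.
move=> ji hj X Y g f sg.
have hd t : idem_free (fdelta t (e t)).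
  by rewrite -[e t]mul1r; exact: idem_free_delta.
have /choice[v hv] : forall t, exists v, j v = fdelta t (e t).
  by move=> t; apply/hj.
have /choice[x hx] : forall t, exists x, g x = f (v t) by move=> t; apply: sg.
(* The generator [v t] goes to [e t *: x t] rather than to [x t]; after [g] this is harmless, as the
   coefficients of [w] absorb [e t]. *)
exists (fev x \o j) => w /=.
have [s hs] := fcoefP (j w).
rewrite /fev (lincombE _ hs) linear_sum.
have wE : w = \sum_(t <- s) fcoef (j w) t *: v t.
  apply: ji; rewrite linear_sum /= {1}(@idem_free_sum (j w) s) //.
    by apply: eq_bigr => t _; rewrite linearZ /= hv.
  by apply/hj; exists w.
rewrite [in RHS]wE linear_sum; apply: eq_bigr => t _.
by rewrite !linearZ /= hx.
Qed.
End FreeProjective.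

Lemma free_projective (T : choiceType) : projective (free_mod R T).
Proof.
apply: (@idem_free_projective T (fun=> 1) _ _ idfun) => [t| |z].
- by rewrite mulr1.
- by [].
- by split=> [_|_ t]; [exists z | rewrite mulr1].
Qed.

Lemma fev_surj M : forall y : M, exists z : free_mod R M, fev id z = y.
Proof. by move=> y; exists (fdelta y 1); rewrite fev_delta scale1r. Qed.

(** All elements of [P] serve as generators, and [fcoef (c x) t] are the dual coordinates of [x]. *)
Lemma dual_basis P : projective P ->
  exists c : {linear P -> free_mod R P}, forall x, fev id (c x) = x.
Proof.
by move=> hP; apply: (hP _ _ (fev id) idfun); exact: fev_surj.
Qed.

End Projective.

(** * Tensor products *)

Lemma additive_ex (U V : zmodType) (f : U -> V) :
  {morph f : x y / x - y} -> exists g : {additive U -> V}, forall x, g x = f x.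
Proof.
move=> hf; pose L := GRing.isZmodMorphism.Build U V f hf.
by exists (HB.pack_for {additive U -> V} f L).
Qed.

(** Differences as the only closure condition match both [tensor_rel] and the definition of additive
    maps. *)
Lemma freeg_ind_sub (T : choiceType) (P : {freeg T / int} -> Prop) :
  P 0 -> (forall t, P <<t>>) -> (forall x y, P x -> P y -> P (x - y)) ->
  forall D, P D.
Proof.
move=> P0 hU hB; have hN x : P x -> P (- x) by rewrite -[- x]add0r; apply: hB.
have hD x y : P x -> P y -> P (x + y) by rewrite -[y in x + y]opprK => ? ?; apply/hB/hN.
have hn t n : P (<<t>> *+ n) by elim: n => // n IH; rewrite mulrSr; apply: hD.
apply: freeg_ind_dom0 => // k t D _ _; apply: hD.
case: k => n; first by rewrite -natz -freegU_muln.
by rewrite NegzE -freegUN; apply: hN; rewrite -[_%:Z]natz -freegU_muln.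
Qed.

Lemma freeg_lift_ex (T : choiceType) (G : zmodType) (f : T -> G) :
  exists L : {additive {freeg T / int} -> G}, forall t, L <<t>> = f t.
Proof.
have [L hL] := @additive_ex {freeg T / int} G
  (@fglift int (zmodule G) T f) (@lift_is_additive int T (zmodule G) f).
by exists L => t; rewrite hL (@liftU int (zmodule G) T) scale1r.
Qed.

Section TensorBasics.
Variable R : pzRingType.

Section One.
Variables (M : lmodType R^c) (N : lmodType R).

Lemma tensor_proj0 : tensor_proj (0 : {freeg (M * N) / int}) = 0.
Proof. by rewrite -[X in tensor_proj X](subrr 0) tensor_projB subrr. Qed.

Lemma tensDl (m m' : M) (n : N) : tens (m + m') n = tens m n + tens m' n.
Proof.
apply/eqP; rewrite -subr_eq0 opprD addrA; apply/eqP.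
rewrite -[RHS](subrr (tens 0 0)) /tens -!tensor_projB; apply/tensor_proj_eq.
by rewrite subrr subr0; apply: Tensor_addl.
Qed.

Lemma tensDr (m : M) (n n' : N) : tens m (n + n') = tens m n + tens m n'.
Proof.
apply/eqP; rewrite -subr_eq0 opprD addrA; apply/eqP.
rewrite -[RHS](subrr (tens 0 0)) /tens -!tensor_projB; apply/tensor_proj_eq.
by rewrite subrr subr0; apply: Tensor_addr.
Qed.

Lemma tensZ (m : M) (r : R) (n : N) : tens ((r : R^c) *: m) n = tens m (r *: n).
Proof. by apply/tensor_proj_eq/Tensor_balanced. Qed.

Lemma tens0l (n : N) : tens (0 : M) n = 0.
Proof. by apply: (addrI (tens (0 : M) n)); rewrite -tensDl !addr0. Qed.

Lemma tens0r (m : M) : tens m (0 : N) = 0.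
Proof. by apply: (addrI (tens m (0 : N))); rewrite -tensDr !addr0. Qed.

Lemma tensNl (m : M) (n : N) : tens (- m) n = - tens m n.
Proof. by apply/eqP; rewrite -addr_eq0 -tensDl addNr tens0l. Qed.

Lemma tensNr (m : M) (n : N) : tens m (- n) = - tens m n.
Proof. by apply/eqP; rewrite -addr_eq0 -tensDr addNr tens0r. Qed.

Lemma tens_sumr (m : M) I (s : seq I) (F : I -> N) :
  tens m (\sum_(i <- s) F i) = \sum_(i <- s) tens m (F i).
Proof.
by elim/big_rec2: _ => [|i x y _ <-]; rewrite ?tens0r ?tensDr.
Qed.

Lemma tensor_ind (P : tensor M N -> Prop) :
  (forall m n, P (tens m n)) -> (forall x y, P x -> P y -> P (x - y)) ->
  forall z, P z.
Proof.
move=> hU hB z; rewrite -[z]tensor_reprK.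
elim/freeg_ind_sub: (tensor_repr z) => [|[m n]|x y hx hy].
- by rewrite tensor_proj0 -(subrr (tens 0 0)); apply: hB; exact: hU.
- exact: hU.
- by rewrite tensor_projB; apply: hB.
Qed.

Lemma tensor_lift_ex (G : zmodType) (f : M -> N -> G) :
  (forall m m' n, f (m + m') n = f m n + f m' n) ->
  (forall m n n', f m (n + n') = f m n + f m n') ->
  (forall m (r : R) n, f ((r : R^c) *: m) n = f m (r *: n)) ->
  exists L : {additive tensor M N -> G}, forall m n, L (tens m n) = f m n.
Proof.
move=> fDl fDr fZ; have [L hL] := freeg_lift_ex (fun p => f p.1 p.2).
have L0 x : tensor_rel x -> L x = 0.
  elim=> [m m' n|m n n'|m r n||{}x y _ hx _ hy].
  - by rewrite !raddfB /= !hL /= fDl addrAC addrK subrr.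
  - by rewrite !raddfB /= !hL /= fDr addrAC addrK subrr.
  - by rewrite !raddfB /= !hL /= fZ subrr.
  - by rewrite raddf0.
  - by rewrite raddfB /= hx hy subrr.
have Lp x : L (tensor_repr (tensor_proj x)) = L x.
  apply/eqP; rewrite -subr_eq0 -raddfB; apply/eqP/L0/tensor_proj_eq.
  by rewrite tensor_reprK.
have [|g hg] := @additive_ex (tensor M N) G (fun z => L (tensor_repr z)).
  move=> x y; rewrite -[x in LHS]tensor_reprK -[y in LHS]tensor_reprK.
  by rewrite -tensor_projB Lp raddfB.
by exists g => m n; rewrite hg Lp hL.
Qed.

End One.

Section TMap.
Variables (M M' : lmodType R^c) (N N' : lmodType R).
Variables (h : {linear M -> M'}) (f : {linear N -> N'}).

Lemma tmap_ex : exists L : {additive tensor M N -> tensor M' N'},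
  forall m n, L (tens m n) = tens (h m) (f n).
Proof.
apply: tensor_lift_ex => [m m' n|m n n'|m r n].
- by rewrite linearD tensDl.
- by rewrite linearD tensDr.
- by rewrite linearZ tensZ linearZ.
Qed.

Definition tmap : {additive tensor M N -> tensor M' N'} := sval (cid tmap_ex).

Lemma tmapE m n : tmap (tens m n) = tens (h m) (f n).
Proof. exact: (svalP (cid tmap_ex)). Qed.

Lemma tmap_surj : (forall y, exists x, h x = y) -> (forall y, exists x, f x = y) ->
  forall z, exists w, tmap w = z.
Proof.
move=> sh sf; apply: tensor_ind => [m n|x y [w <-] [w' <-]].
  have [m' <-] := sh m; have [n' <-] := sf n.
  by exists (tens m' n'); rewrite tmapE.
by exists (w - w'); rewrite raddfB.
Qed.

(* Set-theoretic sections of [h] and [f] give a map [M' (x) N' -> M (x) N] that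
   is well defined modulo [G]. *)
Lemma tmap_ker (G : tensor M N -> Prop) :
  (forall y, exists x, h x = y) -> (forall y, exists x, f x = y) ->
  (forall x y, G x -> G y -> G (x - y)) ->
  (forall m n, h m = 0 -> G (tens m n)) ->
  (forall m n, f n = 0 -> G (tens m n)) ->
  forall z, tmap z = 0 -> G z.
Proof.
move=> /choice[s hs] /choice[t ht] GB Gl Gr.
have G0 : G 0 by rewrite -(tens0l M (0 : N)); apply: Gl; rewrite linear0.
have GD x y : G x -> G y -> G (x + y).
  by move=> hx hy; rewrite -[y]opprK -[- y]add0r; exact: GB hx (GB _ _ G0 hy).
have [S hS] := freeg_lift_ex (fun p : M' * N' => tens (s p.1) (t p.2)).
have Srel x : tensor_rel x -> G (S x).
  elim=> [m m' n|m n n'|m r n||{}x y _ hx _ hy].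
  - rewrite !raddfB /= !hS /= -!tensNl -!tensDl; apply: Gl.
    by rewrite !linearD !linearN /= !hs addrAC addrK subrr.
  - rewrite !raddfB /= !hS /= -!tensNr -!tensDr; apply: Gr.
    by rewrite !linearD !linearN /= !ht addrAC addrK subrr.
  - rewrite !raddfB /= !hS /=.
    rewrite -[tens (s ((r : R^c) *: m)) _](subrK (tens ((r : R^c) *: s m) (t n))) -addrA.
    apply: GD; first by rewrite -tensNl -tensDl; apply: Gl; rewrite linearB linearZ /= !hs subrr.
    by rewrite tensZ -tensNr -tensDr; apply: Gr; rewrite linearB linearZ /= !ht subrr.
  - by rewrite raddf0.
  - by rewrite raddfB; apply: GB.
have [F hF] := freeg_lift_ex (fun p : M * N => <<(h p.1, f p.2)>> : {freeg (M' * N') / int}).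
(* Going to [M' (x) N'] and back is the identity modulo [G], so a class whose image is a relation
   lies in [G] by [Srel]. *)
have FS x : G (tensor_proj x - S (F x)).
  elim/freeg_ind_sub: x => [|[m n]|x y hx hy].
  - by rewrite tensor_proj0 (raddf0 F) (raddf0 S) subr0.
  - rewrite hF hS /= -/(tens m n) -[tens m n](subrK (tens (s (h m)) n)) -addrA.
    apply: GD; first by rewrite -tensNl -tensDl; apply: Gl; rewrite linearB /= hs subrr.
    by rewrite -tensNr -tensDr; apply: Gr; rewrite linearB /= ht subrr.
  - by rewrite tensor_projB (raddfB F) (raddfB S) opprB addrACA [_ - S _]addrC
      addrACA -[_ - tensor_proj y]opprB; apply: GB.
have tF x : tmap (tensor_proj x) = tensor_proj (F x).
  elim/freeg_ind_sub: x => [|[m n]|x y hx hy].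
  - by rewrite tensor_proj0 (raddf0 F) tensor_proj0 raddf0.
  - by rewrite hF -/(tens m n) tmapE.
  - by rewrite tensor_projB !raddfB /= hx hy tensor_projB.
move=> z; rewrite -[z]tensor_reprK tF => hz.
rewrite -[tensor_proj _](subrK (S (F (tensor_repr z)))); apply: GD => //.
apply: Srel; rewrite -[F _]subr0; apply/tensor_proj_eq; rewrite hz.
by rewrite tensor_proj0.
Qed.

End TMap.
End TensorBasics.

(** * Right exactness, flatness and dimension shifting *)

Section Exactness.
Variable R : pzRingType.
Implicit Types (X Y F : lmodType R^c) (K P N : lmodType R).

(** The composites are separate maps [g] and [k] with pointwise equations, so that identities and
    zero maps can be put in their place. *)
Lemma tmap_comp X X' X'' N N' N'' (h : {linear X -> X'}) (h' : {linear X' -> X''})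
    (f : {linear N -> N'}) (f' : {linear N' -> N''}) (g : {linear X -> X''})
    (k : {linear N -> N''}) :
  (forall x, h' (h x) = g x) -> (forall x, f' (f x) = k x) ->
  forall z, tmap h' f' (tmap h f z) = tmap g k z.
Proof.
move=> hg fk; apply: tensor_ind => [m n|x y hx hy].
  by rewrite !tmapE hg fk.
by rewrite !raddfB /= hx hy.
Qed.

(** An instance of [tmap_ker], with the image of [X (x) K] as [G]. *)
Lemma tmap_exact_r X K P N (i : {linear K -> P}) (p : {linear P -> N}) :
  ses i p -> forall z : tensor X P, tmap idfun p z = 0 ->
  exists w : tensor X K, tmap idfun i w = z.
Proof.
move=> [_ sp ex]; apply: tmap_ker => //.
- by move=> y; exists y.
- by move=> x y [w <-] [w' <-]; exists (w - w'); rewrite raddfB.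
- by move=> m n /= ->; exists 0; rewrite raddf0 tens0l.
- by move=> m n /ex[k <-]; exists (tens m k); rewrite tmapE.
Qed.

Lemma tmap_exact_l (N : lmodType R) (K' P' X' : lmodType R^c)
    (i : {linear K' -> P'}) (p : {linear P' -> X'}) :
  ses i p -> forall z : tensor P' N, tmap p idfun z = 0 ->
  exists w : tensor K' N, tmap i idfun w = z.
Proof.
move=> [_ sp ex]; apply: tmap_ker => //.
- by move=> y; exists y.
- by move=> x y [w <-] [w' <-]; exists (w - w'); rewrite raddfB.
- by move=> m n /ex[k <-]; exists (tens k n); rewrite tmapE.
- by move=> m n /= ->; exists 0; rewrite raddf0 tens0r.
Qed.

Lemma tensor_mapE X N N' (f : {linear N -> N'}) (z : tensor X N) :
  tensor_map f z = tmap idfun f z.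
Proof.
elim/tensor_ind: z => [m n|x y hx hy]; first by rewrite tensor_map_tens tmapE.
by rewrite tensor_mapB hx hy raddfB.
Qed.

Lemma flat_tmap X N N' (f : {linear N -> N'}) (z : tensor X N) :
  flat X -> injective f -> tmap idfun f z = 0 -> z = 0.
Proof.
move=> hX fi; rewrite -tensor_mapE => h; apply: (hX _ _ f fi).
by rewrite h tensor_mapE raddf0.
Qed.

(* Vanishing in [X (x) P] is tested on the coordinates in a dual basis of [P]. *)
Lemma projective_tmap X Y P (i : {linear X -> Y}) (z : tensor X P) :
  projective P -> injective i -> tmap i idfun z = 0 -> z = 0.
Proof.
move=> /dual_basis[c hc] ii hz.
have coord (W : lmodType R^c) (t : P) : exists g : {additive tensor W P -> W},
    forall x p, g (tens x p) = (fcoef (c p) t : R^c) *: x.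
  apply: tensor_lift_ex => [m m' n|m n n'|m r n].
  - by rewrite scalerDr.
  - by rewrite linearD fcoefD scalerDl.
  - by rewrite linearZ fcoefZ scalerA.
have [g hg] := choice (coord X); have [g' hg'] := choice (coord Y).
have gi t w : i (g t w) = g' t (tmap i idfun w).
  elim/tensor_ind: w => [x p|x y hx hy]; first by rewrite tmapE hg hg' linearZ.
  by rewrite !raddfB /= hx hy.
have [s [_ _ ->]] : exists s, [/\ uniq s, forall t, t \notin s -> g t z = 0 &
    z = \sum_(t <- s) tens (g t z) t].
  elim/tensor_ind: {hz} z => [x p|x y [s [us hs xE]] [s' [us' hs' yE]]].
    have [s [us hs]] := fcoefP (c p); exists s; split=> // [t /hs h|].
      by rewrite hg h scale0r.
    rewrite -{1}(hc p) /fev (lincombE _ (conj us hs)) tens_sumr.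
    by apply: eq_bigr => t _; rewrite hg tensZ.
  have hu u : u \notin undup (s ++ s') -> g u x = 0 /\ g u y = 0.
    by rewrite mem_undup mem_cat negb_or => /andP[/hs ? /hs' ?].
  exists (undup (s ++ s')); split; first exact: undup_uniq.
    by move=> t /hu[h h']; rewrite raddfB /= h h' subrr.
  under eq_bigr do rewrite raddfB tensDl tensNl.
  rewrite sumrB {1}xE {1}yE; congr (_ - _); apply: big_supp => //;
    rewrite ?undup_uniq // => t.
  - by move=> /hs->; rewrite tens0l.
  - by move=> /hu[-> _]; rewrite tens0l.
  - by move=> /hs'->; rewrite tens0l.
  - by move=> /hu[_ ->]; rewrite tens0l.
rewrite big1 // => t _.
have -> : g t z = 0 by apply: ii; rewrite gi hz raddf0 linear0.
by rewrite tens0l.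
Qed.

(* Since [F] is flat, the hypothesis says [Tor_1(X, N) = 0], and the conclusion
   is the same vanishing read off from the resolution of [N]. *)
Lemma tor_shift (X' F X : lmodType R^c) (K P N : lmodType R)
    (j : {linear X' -> F}) (q : {linear F -> X})
    (i : {linear K -> P}) (p : {linear P -> N}) :
  ses j q -> ses i p -> flat F ->
  (forall z : tensor X' N, tmap j idfun z = 0 -> z = 0) ->
  forall z : tensor X K, tmap idfun i z = 0 -> z = 0.
Proof.
move=> Sj Si hF hj z hz; have [ij sq exq] := Sj; have [ii sp exp] := Si.
(* The chase: [y] in [F (x) K] lifts [z]; its image in [F (x) P] comes from [w] in [X' (x) P], and
   [w] from [v] in [X' (x) K] because [X' (x) N] embeds in [F (x) N]. Flatness of [F] identifies [y]
   with the image of [v], which dies in [X (x) K]. *)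
have [|y hy] := tmap_surj (h := q) (f := @idfun K) sq _ z; first by move=> u; exists u.
have [w hw] : exists w : tensor X' P, tmap j idfun w = tmap idfun i y.
  apply: (tmap_exact_l Sj); rewrite -hz -hy.
  by rewrite (tmap_comp (g := q) (k := i)) // (tmap_comp (g := q) (k := i)).
have [v hv] : exists v : tensor X' K, tmap idfun i v = w.
  apply: (tmap_exact_r Si); apply: hj.
  rewrite (tmap_comp (g := j) (k := p)) //.
  rewrite -(tmap_comp (h := j) (f := idfun) (h' := idfun) (f' := p)) // hw.
  rewrite (tmap_comp (g := idfun) (k := \0)) // => [|x]; last by rewrite /= (ses_comp0 x Si).
  elim/tensor_ind: {hy hw} y => [m n|a b ha hb]; first by rewrite tmapE tens0r.
  by rewrite raddfB /= ha hb subrr.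
have yE : y = tmap j idfun v.
  apply/eqP; rewrite -subr_eq0; apply/eqP; apply: (flat_tmap hF ii).
  rewrite raddfB /= -hw -hv (tmap_comp (g := j) (k := i)) //.
  by rewrite (tmap_comp (g := j) (k := i)) // subrr.
rewrite -hy yE (tmap_comp (g := \0) (k := idfun)) // => [|x]; last by rewrite (ses_comp0 x Sj).
elim/tensor_ind: {hv yE} v => [m n|a b ha hb]; first by rewrite tmapE tens0l.
by rewrite raddfB /= ha hb subrr.
Qed.

Lemma flat_iso F X (f : {linear F -> X}) : injective f ->
  (forall y, exists x, f x = y) -> flat F -> flat X.
Proof.
move=> fi fs hF N N' u ui; have [g hg] := @factor_inj _ _ _ _ f idfun fi fs.
have gK x : f (g x) = x by rewrite hg.
have inj0 (z : tensor X N) : tmap idfun u z = 0 -> z = 0.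
  move=> hz; have -> : z = tmap f idfun (tmap g idfun z).
    rewrite (tmap_comp (g := idfun) (k := idfun)) //.
    by elim/tensor_ind: {hz} z => [m n|a b ha hb]; rewrite ?tmapE // raddfB /= -ha -hb.
  rewrite (flat_tmap (z := tmap g idfun z) hF ui) ?raddf0 //.
  rewrite (tmap_comp (g := g) (k := u)) //.
  rewrite -(tmap_comp (h := idfun) (f := u) (h' := g) (f' := idfun)) // hz.
  exact: raddf0.
move=> x y /eqP; rewrite -subr_eq0 -tensor_mapB tensor_mapE => /eqP/inj0/eqP.
by rewrite subr_eq0 => /eqP.
Qed.
End Exactness.

(** * Extension of scalars *)

Section Extension.
Variables (A B : pzRingType) (phi : {rmorphism A -> B}).
Local Notation BA := (right_restriction phi).
Implicit Types (N P : lmodType A).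

Lemma left_mul_ex (b : B) : exists g : {linear BA -> BA}, forall x : BA, g x = (b * (x : B) : B).
Proof.
apply: linear_ex => a x y; have -> : (b * ((a *: x + y : BA) : B) : B) =
  b * ((x : B) * phi a + (y : B)) by [].
by rewrite mulrDr mulrA.
Qed.

Definition left_mul (b : B) : {linear BA -> BA} := sval (cid (left_mul_ex b)).

Lemma left_mulE (b x : B) : left_mul b (x : BA) = b * x.
Proof. exact: (svalP (cid (left_mul_ex b))). Qed.

Section Obj.
Variable N : lmodType A.

(** A named copy of [B (x) N] to carry the left [B]-action, which comes from the bimodule structure
    of [B]. *)
Definition ext : Type := tensor BA N.
HB.instance Definition _ := GRing.Zmodule.on ext.

Definition ext_scale (b : B) (z : ext) : ext := tmap (left_mul b) idfun (z : tensor BA N).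

Lemma ext_scale_tens (b x : B) (n : N) : ext_scale b (tens (x : BA) n) = tens (b * x : BA) n.
Proof. by rewrite /ext_scale tmapE left_mulE. Qed.

Lemma ext_scaleBr b : {morph ext_scale b : x y / x - y}.
Proof. exact: raddfB. Qed.

Lemma ext_scaleA a b z : ext_scale a (ext_scale b z) = ext_scale (a * b) z.
Proof.
elim/tensor_ind: z => [m n|x y hx hy]; first by rewrite !ext_scale_tens mulrA.
by rewrite !ext_scaleBr hx hy.
Qed.

Lemma ext_scale1 : left_id 1 ext_scale.
Proof.
elim/tensor_ind => [m n|x y hx hy]; first by rewrite ext_scale_tens mul1r.
by rewrite !ext_scaleBr hx hy.
Qed.

Lemma ext_scaleDr : right_distributive ext_scale +%R.
Proof. by move=> b x y; exact: raddfD. Qed.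

Lemma ext_scaleDl z : {morph ext_scale^~ z : a b / a + b}.
Proof.
move=> a b; elim/tensor_ind: z => [m n|x y hx hy].
  by rewrite !ext_scale_tens mulrDl -tensDl.
by rewrite !ext_scaleBr hx hy opprD addrACA.
Qed.

HB.instance Definition _ := GRing.Zmodule_isLmodule.Build B ext
  ext_scaleA ext_scale1 ext_scaleDr ext_scaleDl.

Definition etens (b : B) (n : N) : ext := tens (b : BA) n.

Lemma etensZ (a b : B) n : a *: etens b n = etens (a * b) n.
Proof. exact: ext_scale_tens. Qed.

Lemma etensDr b n n' : etens b (n + n') = etens b n + etens b n'.
Proof. exact: tensDr. Qed.

Lemma etens_bal (b : B) (a : A) n : etens (b * phi a) n = etens b (a *: n).
Proof. exact: (@tensZ _ BA N b a n). Qed.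

Lemma etens0 b : etens b 0 = 0.
Proof. exact: tens0r. Qed.

Lemma etens_sum b I (s : seq I) (F : I -> N) :
  etens b (\sum_(i <- s) F i) = \sum_(i <- s) etens b (F i).
Proof. exact: tens_sumr. Qed.

Lemma ext_ind (P : ext -> Prop) :
  (forall b n, P (etens b n)) -> (forall x y, P x -> P y -> P (x - y)) ->
  forall z, P z.
Proof. by move=> h1 h2; apply: tensor_ind. Qed.

Lemma ext_lift_ex (X : lmodType B) (f : {additive N -> X}) :
  (forall (a : A) n, f (a *: n) = phi a *: f n) ->
  exists g : {linear ext -> X}, forall b n, g (etens b n) = b *: f n.
Proof.
move=> fZ; have [||m r n|L hL] := @tensor_lift_ex _ BA N X (fun b n => (b : B) *: f n).
- by move=> m m' n; exact: scalerDl.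
- by move=> m n n'; rewrite raddfD scalerDr.
- by rewrite fZ scalerA.
have [g hg] : exists g : {linear ext -> X}, forall z, g z = L z.
  apply: linear_ex => b z w; rewrite raddfD; congr (_ + _).
  elim/ext_ind: z => [c n|x y hx hy]; first by rewrite etensZ !hL scalerA.
  by rewrite scalerBr !raddfB /= hx hy.
by exists g => b n; rewrite hg hL.
Qed.
End Obj.

Lemma ext_map_ex N P (f : {linear N -> P}) :
  exists g : {linear ext N -> ext P}, forall z, g z = tmap idfun f z.
Proof.
have fE c n : tmap idfun f (etens c n) = etens c (f n) :> ext P by exact: tmapE.
apply: linear_ex => b z w; rewrite raddfD; congr (_ + _).
elim/ext_ind: z => [c n|x y hx hy]; first by rewrite etensZ !fE etensZ.
rewrite scalerBr raddfB hx hy raddfB; exact/esym/scalerBr.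
Qed.

Definition ext_map N P (f : {linear N -> P}) : {linear ext N -> ext P} :=
  sval (cid (ext_map_ex f)).

Lemma ext_mapE N P (f : {linear N -> P}) z : ext_map f z = tmap idfun f z.
Proof. exact: (svalP (cid (ext_map_ex f))). Qed.

Lemma ext_map_tens N P (f : {linear N -> P}) b n : ext_map f (etens b n) = etens b (f n).
Proof. by rewrite ext_mapE tmapE. Qed.

Lemma ext_map_surj N P (f : {linear N -> P}) :
  (forall y, exists x, f x = y) -> forall z, exists w, ext_map f w = z.
Proof.
move=> sf z; have [|w <-] := tmap_surj (h := @idfun BA) _ sf z; first by move=> y; exists y.
by exists w; rewrite ext_mapE.
Qed.

Lemma ext_ses (K P N : lmodType A) (i : {linear K -> P}) (p : {linear P -> N}) :
  ses i p -> (forall z, ext_map i z = 0 -> z = 0) -> ses (ext_map i) (ext_map p).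
Proof.
move=> S h; have [ii sp ex] := S; split=> [||z].
- exact: linear_injP.
- exact: ext_map_surj.
split=> [|[w <-]].
  by rewrite ext_mapE => /(tmap_exact_r S)[w hw]; exists w; rewrite ext_mapE.
elim/ext_ind: w => [b n|x y hx hy].
  by rewrite !ext_map_tens (ses_comp0 n S) etens0.
by rewrite !raddfB /= hx hy subrr.
Qed.

(** Coordinates survive extension of scalars through [phi]. This makes [ext P] a retract of a free
    module, and later detects elements of the kernel of [phi]. *)
Lemma ext_coord P (c : {linear P -> free_mod A P}) :
  exists g : {linear ext P -> free_mod B P}, forall b x t,
    fcoef (g (etens b x)) t = b * phi (fcoef (c x) t).
Proof.
have /choice[f hf] : forall x, exists z : free_mod B P, forall t, fcoef z t = phi (fcoef (c x) t).
  move=> x; apply: free_mod_ex; have [s [us hs]] := fcoefP (c x).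
  by exists s; split=> // t /hs->; rewrite rmorph0.
have [|f' hf'] := @additive_ex P (free_mod B P) f.
  by move=> x y; apply: fcoef_inj => t; rewrite fcoefB !hf linearB fcoefB rmorphB.
have [|g hg] := @ext_lift_ex P _ f'.
  by move=> a n; apply: fcoef_inj => t; rewrite fcoefZ !hf' !hf linearZ fcoefZ rmorphM.
by exists g => b x t; rewrite hg fcoefZ hf' hf.
Qed.

Lemma ext_projective P : projective P -> projective (ext P).
Proof.
move=> /dual_basis[c hc]; have [g hg] := ext_coord c.
apply: (@projective_retract B _ _ g (fev (etens 1))); last exact: free_projective.
apply: ext_ind => [b x|x y hx hy]; last by rewrite !raddfB /= hx hy.
have [s hs] := fcoefP (c x).
rewrite /= /fev (@lincombE _ _ _ _ _ s).
  under eq_bigr do rewrite hg etensZ mulr1 etens_bal.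
  by rewrite -etens_sum -(lincombE _ hs) [X in etens _ X]hc.
by case: hs => us hs; split=> // t /hs h; rewrite hg h rmorph0 mulr0.
Qed.

Lemma ext_pdle_ses n (K P N : lmodType A) (i : {linear K -> P}) (p : {linear P -> N}) :
  ses i p -> projective P -> (forall z, ext_map i z = 0 -> z = 0) ->
  pdle n (ext K) -> pdle n.+1 (ext N).
Proof.
move=> S hP h hK; exists (ext K), (ext P), (ext_map i), (ext_map p).
by split=> //; [exact: ext_ses | exact: ext_projective].
Qed.

End Extension.

(** * Resolutions and dimensions *)

Section Resolutions.
Variables (R : pzRingType) (C : lmodType R -> Prop).
Implicit Types M K P Z : lmodType R.

(** At 0 the class is met only up to isomorphism: [C] need not be closed under isomorphism, and the
    last term of a resolution is merely isomorphic to the module. *)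
Fixpoint cdle (n : nat) M : Prop :=
  if n is m.+1 then
    exists K P (i : {linear K -> P}) (p : {linear P -> M}),
      [/\ ses i p, C P & cdle m K]
  else exists P (p : {linear P -> M}),
      [/\ injective p, forall y, exists x, p x = y & C P].

Lemma has_resolution_cdle n M : has_resolution C M n -> cdle n M.
Proof.
elim: n M => [|n IH] M [X [hC h0]].
  exists (X 0%N), (res_aug X); split=> //; last exact: res_aug_surj.
  apply: linear_injP => x /res_exact_aug[y <-].
  by rewrite (h0 1%N _ y) // linear0.
have [K [i S]] := ses_kernel (@res_aug_surj _ _ X); have [ii sp ex] := S.
exists K, (X 0%N), i, (res_aug X); split=> //; apply: IH.
(* Corestricted to the kernel [K], the first differential is the augmentation of the shifted
   complex. *)
have [|a ha] := @factor_inj _ _ _ _ i (res_diff X 0) ii.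
  by move=> x; apply/ex/res_exact_aug; exists x.
have as' : forall k, exists x, a x = k.
  move=> k; have /res_exact_aug[x hx] : res_aug X (i k) = 0 by apply/ex; exists k.
  by exists x; apply: ii; rewrite ha.
have aex x : a x = 0 <-> exists y, res_diff X 1 y = x.
  by rewrite -res_exact -ha; split=> [->|]; [exact: linear0 | rewrite -{1}(linear0 i) => /ii].
exists (@Resolution _ K (fun i => X i.+1) (fun i => res_diff X i.+1) a as' aex
  (fun i => @res_exact _ _ X i.+1)).
by split=> /= [j|j hj]; [exact: hC | exact: h0].
Qed.

(** Prepending [P] raises degrees by one, hence [n <= j] for [Y] against [n < i] for the result. The
    case [n = 0] makes [Y] a resolution by zero modules. *)
Lemma has_resolution_cons n M K P (i : {linear K -> P}) (p : {linear P -> M}) :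
  ses i p -> C P -> forall Y : resolution K, (forall j, C (Y j)) ->
  (forall j, (n <= j)%N -> forall y : Y j, y = 0) -> has_resolution C M n.
Proof.
move=> [ii sp ex] hP Y hC h0.
pose obj j : lmodType R := if j is k.+1 then Y k else P.
pose diff j : {linear obj j.+1 -> obj j} :=
  match j return {linear obj j.+1 -> obj j} with
  | 0 => (i \o res_aug Y : {linear Y 0%N -> P})
  | k.+1 => res_diff Y k end.
have hex0 x : p x = 0 <-> exists y, diff 0%N y = x.
  rewrite ex; split=> [[k <-]|[y <-]]; last by exists (res_aug Y y).
  by have [y <-] := @res_aug_surj _ _ Y k; exists y.
have hex j x : diff j x = 0 <-> exists y, diff j.+1 y = x.
  case: j x => [|j] x /=; last exact: res_exact.
  by rewrite -res_exact_aug; split=> [|->]; [rewrite -{1}(linear0 i) => /ii | exact: linear0].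
exists (@Resolution _ M obj diff p sp hex0 hex).
by split=> [[|j]//|[//|j] hj] /=; [exact: hC | exact: h0].
Qed.

Lemma has_resolution_mono m n M : (m <= n)%N ->
  has_resolution C M m -> has_resolution C M n.
Proof.
move=> mn [X [hC h0]]; exists X; split=> // i hi; apply: h0; exact: leq_ltn_trans hi.
Qed.
End Resolutions.

Section ProjectiveResolutions.
Variable R : pzRingType.
Implicit Types M K P Z : lmodType R.

Lemma zero_resolution_ex Z : (forall z : Z, z = 0) ->
  exists Y : resolution Z, forall j, Y j = Z.
Proof.
move=> hZ.
have s0 : forall x : Z, exists y, (idfun : {linear Z -> Z}) y = x by move=> x; exists x.
have e0 (x : Z) : (idfun : {linear Z -> Z}) x = 0 <-> exists y, (\0 : {linear Z -> Z}) y = x.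
  by rewrite /= (hZ x); split=> // _; exists 0.
have e1 (j : nat) (x : Z) : (\0 : {linear Z -> Z}) x = 0 <-> exists y, (\0 : {linear Z -> Z}) y = x.
  by split=> // _; exists 0; rewrite (hZ x).
by exists (@Resolution _ Z (fun=> Z) (fun=> \0) idfun s0 e0 e1).
Qed.

Lemma pdle_has_resolution n M : pdle n M <-> has_resolution (@projective R) M n.
Proof.
split.
- elim: n M => [|n IH] M; last first.
    by move=> [K [P [i [p [S hP /IH[Y [hY h0]]]]]]]; exact: has_resolution_cons S hP Y hY h0.
  (* The kernel of the identity provides the zero module that fills the positive degrees. *)
  move=> hM; have [Z [i S]] := zero_ses M.
  have hZ (z : Z) : z = 0 by case: S => ii _ ex; apply: ii; rewrite linear0; apply/ex; exists z.
  have [Y hY] := zero_resolution_ex hZ.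
  apply: (has_resolution_cons S hM (Y := Y)) => [j|j _]; rewrite hY //.
  exact: projective_zero.
- move=> /has_resolution_cdle; elim: n M => [|n IH] M /=.
    by move=> [P [p [pi ps hP]]]; exact: (@pdle_iso _ 0 _ _ p pi ps hP).
  by move=> [K [P [i [p [S hP /IH hK]]]]]; exists K, P, i, p.
Qed.
End ProjectiveResolutions.

(** * Dimensions as extended integers *)

Section Dimensions.
Local Open Scope ereal_scope.

Lemma infimum_nat (P : nat -> Prop) :
  let d := infimum +oo [set d : \bar int | exists n : nat, P n /\ d = (n%:Z)%:E] in
  (d = +oo /\ forall n, ~ P n) \/
  (exists n, [/\ d = (n%:Z)%:E, P n & forall m, P m -> (n <= m)%N]).
Proof.
set S := [set d | _]; rewrite /=.
have [[n0 hn0]|hn] := pselect (exists n, P n); last first.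
  have hP n : ~ P n by move=> h; apply: hn; exists n.
  left; split=> //; rewrite /infimum ifT //; apply/eqP.
  by rewrite predeqE => x; split=> // -[n [/hP]].
right; have ex : exists n, `[< P n >] by exists n0; apply/asboolP.
case: (ex_minnP ex) => n /asboolP hPn hmin; exists n.
have {}hmin m : P m -> (n <= m)%N by move=> h; apply: hmin; apply/asboolP.
split=> //; rewrite /infimum ifF; last first.
  by apply/negP => /eqP S0; have : S (n%:Z)%:E by [exists n]; rewrite S0.
have hI : infimums S (n%:Z)%:E.
  split=> [_ [m [/hmin nm ->]]|y hy]; first by rewrite lee_fin lez_nat.
  by apply: hy; exists n.
case: xgetP => [y _ hy|/(_ _ hI)//].
exact: is_subset1_infimums hy hI.
Qed.

(** Existence is the point. A nonempty set of this kind either has a natural upper bound, and then a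
    least one, or has only [+oo] as upper bound; the empty set has supremum [-oo]. *)
Lemma supremum_natP (S : set (\bar int)) : (forall x, S x -> 0 <= x) ->
  (forall x, S x -> x <= supremum -oo S) /\
  (forall u, (forall x, S x -> x <= u) -> supremum -oo S <= u).
Proof.
move=> S0; have [[x0 hx0]|hS] := pselect (exists x, S x); last first.
  have SE : S = set0 by rewrite predeqE => x; split=> // h; apply: hS; exists x.
  by rewrite SE supremum0; split=> // u _; exact: leNye.
suff [y hy] : exists y, supremums S y.
  have hs : supremums S (supremum -oo S).
    rewrite /supremum ifF; first by case: xgetP => [z _ //|/(_ _ hy)].
    by apply/negP => /eqP SE; rewrite SE in hx0.
  by split=> [x hx|u hu]; [exact: hs.1 | apply: hs.2].
have [[n0 hn0]|hn] := pselect (exists n : nat, ubound S (n%:Z)%:E); last first.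
  exists +oo; split=> [x _|u hu]; first exact: leey.
  have : 0 <= u by apply: le_trans (hu _ hx0); exact: S0.
  case: u hu => // -[k|//] hu _.
  by case: hn; exists k.
have ex : exists n : nat, `[< ubound S (n%:Z)%:E >] by exists n0; apply/asboolP.
case: (ex_minnP ex) => n /asboolP hPn hmin; exists (n%:Z)%:E; split=> // u hu.
have : 0 <= u by apply: le_trans (hu _ hx0); exact: S0.
case: u hu => [[k|//]||//] hu _; last exact: leey.
by rewrite lee_fin lez_nat; apply: hmin; apply/asboolP.
Qed.

Section ProjDim.
Variable R : pzRingType.
Implicit Types M : lmodType R.

Lemma resolution_dim_le (C : lmodType R -> Prop) M n :
  has_resolution C M n -> resolution_dim C M <= (n%:Z)%:E.
Proof.
move=> h; case: (infimum_nat (has_resolution C M)) => [[_ /(_ n)]//|[m [e _ hm]]].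
by rewrite /resolution_dim e lee_fin lez_nat; apply: hm.
Qed.

Lemma resolution_dim_fin (C : lmodType R -> Prop) M :
  resolution_dim C M = +oo \/
  exists n : nat, resolution_dim C M = (n%:Z)%:E /\ has_resolution C M n.
Proof.
case: (infimum_nat (has_resolution C M)) => [[e _]|[m [e h _]]]; first by left.
by right; exists m.
Qed.

Lemma resolution_dim_ge0 (C : lmodType R -> Prop) M : 0 <= resolution_dim C M.
Proof. by case: (resolution_dim_fin C M) => [->//|[n [-> _]]]; rewrite lee_fin. Qed.

Lemma proj_dim_le M n : proj_dim M <= (n%:Z)%:E <-> pdle n M.
Proof.
rewrite pdle_has_resolution; split; last exact: resolution_dim_le.
rewrite /proj_dim; case: (resolution_dim_fin (@projective R) M) => [->//|[m [-> h]]].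
by rewrite lee_fin lez_nat => mn; apply: has_resolution_mono h.
Qed.

Lemma proj_dim_fin M : proj_dim M < +oo <-> exists n, pdle n M.
Proof.
split=> [|[n /proj_dim_le h]]; last exact: le_lt_trans h (ltry _).
case: (resolution_dim_fin (@projective R) M) => [e|[m [e h]] _].
  by rewrite /proj_dim e.
by exists m; apply/pdle_has_resolution.
Qed.

(* The common form of [fin_dim], [Fin_dim] and [gl_dim]. *)
Definition sup_pd (D : lmodType R -> Prop) : \bar int :=
  supremum -oo [set d | exists M, D M /\ d = proj_dim M].

Lemma sup_pdP D :
  (forall M, D M -> proj_dim M <= sup_pd D) /\
  (forall u, (forall M, D M -> proj_dim M <= u) -> sup_pd D <= u).
Proof.
have [|h1 h2] := @supremum_natP [set d | exists M, D M /\ d = proj_dim M].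
  by move=> _ [M [_ ->]]; exact: resolution_dim_ge0.
split=> [M hM|u hu]; first by apply: h1; exists M.
by apply: h2 => _ [M [hM ->]]; exact: hu.
Qed.
End ProjDim.

(** A member of [DB] makes the supremum nonnegative, which rules out [-oo] on the right. If a
    summand is [+oo] the bound is trivial; otherwise both are natural numbers [b] and [d]. *)
Lemma sup_pd_add_le (A B : pzRingType) (DA : lmodType A -> Prop)
    (DB : lmodType B -> Prop) (X : lmodType A^c) :
  (exists N, DB N) ->
  (forall b d : nat, has_resolution (@flat A) X d ->
    (forall N, DB N -> pdle b N) -> forall M, DA M -> pdle (b + d) M) ->
  sup_pd DA <= sup_pd DB + flat_dim X.
Proof.
move=> [N0 hN0] h; have [hB _] := sup_pdP DB; have [_ hA] := sup_pdP DA.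
have sB0 : 0 <= sup_pd DB by apply: le_trans (hB _ hN0); exact: resolution_dim_ge0.
case: (resolution_dim_fin (@flat A) X) => [e|[d [e hd]]].
  by rewrite /flat_dim e addey ?leey //; case: (sup_pd DB) sB0.
rewrite /flat_dim e; case E : (sup_pd DB) sB0 => [[b|//]||//] _; last by rewrite leey.
apply: hA => M hM; rewrite -EFinD -PoszD; apply/proj_dim_le.
by apply: h hM => // N hN; apply/proj_dim_le; rewrite -E; apply: hB.
Qed.

Lemma fin_dimE (R : pzRingType) : fin_dim R =
  sup_pd (fun M : lmodType R => finitely_generated M /\ proj_dim M < +oo).
Proof.
congr supremum; rewrite predeqE => d; split=> [[M [h1 h2 ->]]|[M [[h1 h2] ->]]];
  by exists M.
Qed.

Lemma gl_dimE (R : pzRingType) : gl_dim R = sup_pd (fun _ : lmodType R => True).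
Proof.
congr supremum; rewrite predeqE => d; split=> [[M ->]|[M [_ ->]]]; by exists M.
Qed.
End Dimensions.

(** * Nakayama's lemma and noetherian rings *)

Lemma set_seq_cons (T : eqType) (x : T) (s : seq T) :
  [set` x :: s] = x |` [set` s].
Proof.
rewrite predeqE => y; rewrite /= inE; split=> [/orP[/eqP->|]|[->|/= ->]].
- by left.
- by right.
- by rewrite eqxx.
- by rewrite orbT.
Qed.

Section Span.
Variable R : pzRingType.
Implicit Types M N : lmodType R.

(** As an intersection, the span gives induction through [lspan_min]: the elements with the desired
    property are shown to form a submodule. *)
Definition lspan M (G : set M) : set M :=
  [set y | forall U : set M, submodule U -> G `<=` U -> U y].

Lemma lspan_submodule M (G : set M) : submodule (lspan G).
Proof.
split=> [U hU _|a x y hx hy U hU GU]; first by case: hU.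
by apply: hU.2; [apply: hx | apply: hy].
Qed.

Lemma sub_lspan M (G : set M) : G `<=` lspan G.
Proof. by move=> x Gx U _; apply. Qed.

Lemma lspan_min M (G U : set M) : submodule U -> G `<=` U -> lspan G `<=` U.
Proof. by move=> hU GU y; apply. Qed.

Lemma lspan_sub M (G H : set M) : G `<=` lspan H -> lspan G `<=` lspan H.
Proof. by apply: lspan_min; exact: lspan_submodule. Qed.

Lemma lspan_id M (U : set M) : submodule U -> lspan U `<=` U.
Proof. by move=> hU; apply: lspan_min. Qed.

Lemma lspan_cons M (G : set M) (x y : M) : lspan (x |` G) y ->
  exists r : R, lspan G (y - r *: x).
Proof.
have [h0 hD hZ hB] := submodule_lin (lspan_submodule G).
apply: (lspan_min (U := [set y | exists r : R, lspan G (y - r *: x)])) => [|z [->|Gy]].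
- split=> [|a u v [r hr] [s hs]]; first by exists 0; rewrite scale0r subr0.
  exists (a * r + s); rewrite scalerDl -scalerA opprD addrACA -scalerBr.
  by apply: hD => //; apply: hZ.
- by exists 1; rewrite scale1r subrr.
- by exists 0; rewrite scale0r subr0; exact: sub_lspan.
Qed.

Lemma finitely_generatedP M : finitely_generated M <->
  exists s : seq M, forall y, lspan [set` s] y.
Proof.
split=> -[s hs]; exists s => y.
  have [c ->] := hs y; apply: submodule_sum => [|i _]; first exact: lspan_submodule.
  have [_ _ hZ _] := submodule_lin (lspan_submodule [set` s]).
  by apply: hZ; apply: sub_lspan; apply: mem_nth.
move: (hs y); apply: (lspan_min (U := [set y | exists c : nat -> R, y = _])) => [|x xs].
  split=> [|a u v [c ->] [d ->]].
    by exists (fun=> 0); rewrite big1 // => i _; rewrite scale0r.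
  exists (fun i => a * c i + d i); rewrite scaler_sumr -big_split.
  by apply: eq_bigr => i _; rewrite scalerDl scalerA.
exists (fun i => (i == index x s)%:R).
have hx : (index x s < size s)%N by rewrite index_mem.
rewrite (bigD1 (Ordinal hx)) //= eqxx scale1r nth_index // big1 ?addr0 // => i hi.
rewrite (_ : (_ == _) = false) ?scale0r //; apply/negbTE; apply: contra hi => /eqP hi.
by apply/eqP/val_inj.
Qed.

Definition jac_gen M : set M :=
  [set y | exists a m, jacobson (a : R) /\ y = a *: m].

Definition nakayama M : Prop := forall U : set M, submodule U ->
  (forall y, lspan (U `|` @jac_gen M) y) -> forall y, U y.

Lemma jac_gen_linear M N (f : {linear M -> N}) y :
  lspan (@jac_gen M) y -> lspan (@jac_gen N) (f y).
Proof.
apply: (lspan_min (U := [set y | lspan (@jac_gen N) (f y)])) => [|_ [a [m [ha ->]]]].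
  split=> [|a u v hx hy /=]; first by rewrite /= linear0; case: (lspan_submodule (@jac_gen N)).
  by rewrite linearP; apply: (lspan_submodule (@jac_gen N)).2.
by apply: sub_lspan; exists a, (f m); rewrite linearZ.
Qed.

Lemma nakayama0 M : nakayama M -> (forall y, lspan (@jac_gen M) y) -> forall y : M, y = 0.
Proof.
move=> nM h; apply: (nM [set x | x = 0]).
  exact: submodule_set0.
by move=> y; apply: (lspan_sub _ (h y)) => x hx; apply: sub_lspan; right.
Qed.

Lemma maximal_left_ideal_ex (L : set R) : left_ideal L -> ~ L 1 ->
  exists m : set R, maximal_left_ideal m /\ L `<=` m.
Proof.
move=> hL L1.
(* Joining [L] to [A] in the predicate makes it hold for the empty set, the union of the empty
   chain. *)
have [|A [[hA A1] Amax]] := @Zorn_bigcup R (fun A => left_ideal (L `|` A) /\ ~ A 1).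
  move=> F FP Ftot; split; last by case=> A FA A1; case: (FP _ FA) => _; apply.
  split; first by left; case: hL.
  have up A x : F A -> (L `|` A) x -> (L `|` \bigcup_(X in F) X) x.
    by move=> FA [|hx]; [left | right; exists A].
  move=> a x y [hx|[A FA hx]] [hy|[A' FA' hy]].
  - by left; exact: hL.2.
  - by apply: (up A') => //; apply: (FP _ FA').1.2; [left | right].
  - by apply: (up A) => //; apply: (FP _ FA).1.2; [right | left].
  - have [AA'|A'A] := Ftot _ _ FA FA'.
      by apply: (up A') => //; apply: (FP _ FA').1.2; right; [exact: AA' |].
    by apply: (up A) => //; apply: (FP _ FA).1.2; right; [|exact: A'A].
exists (L `|` A); split; last by left.
split=> // [LT|L' hL' LAL'].
  by have : (L `|` A) 1 by [rewrite LT]; case.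
have [L'1|L'1] := pselect (L' 1).
  right; rewrite predeqE => x; split=> // _; rewrite -[x]mulr1.
  exact: left_idealM.
left; rewrite eqEsubset; split=> // x L'x; apply: contrapT => nx.
apply: (Amax L'); last first.
  split=> //; rewrite (_ : L `|` L' = L') // predeqE => y; split=> [[Ly|//]|]; last by right.
  by apply: LAL'; left.
split=> [y hy|e]; first by apply: LAL'; right.
by apply: nx; right; apply: e.
Qed.

(** Otherwise a maximal left ideal contains [1 - j], and also [j], hence 1. *)
Lemma jacobson_left_inv (j : R) : jacobson j -> exists u, u * (1 - j) = 1.
Proof.
move=> hj; apply: contrapT => h.
pose L := [set x : R | exists u, x = u * (1 - j)].
have hL : left_ideal L.
  split=> [|a _ _ [u ->] [v ->]]; first by exists 0; rewrite mul0r.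
  by exists (a * u + v); rewrite mulrDl -mulrA.
have [|m [hm Lm]] := maximal_left_ideal_ex hL; first by case=> u hu; apply: h; exists u.
have [hml mT _] := hm; apply: mT; rewrite predeqE => x; split=> // _.
rewrite -[x]mulr1; apply: left_idealM => //; rewrite -(subrK j 1).
by apply: left_idealD; [| apply: Lm; exists 1; rewrite mul1r | exact: hj].
Qed.

(** Generators modulo [U] are discarded one at a time: [x] is congruent to [j x] modulo the others
    with [j] in the radical, and [1 - j] is left invertible. *)
Lemma finitely_generated_nakayama M : finitely_generated M -> nakayama M.
Proof.
move=> /finitely_generatedP[s hs] U hU hJ.
have {hs} : forall y, lspan (U `|` [set` s]) y.
  by move=> y; apply: lspan_sub (hs y) => x hx; apply: sub_lspan; right.
elim: s => [|x s IH] hs.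
  by move=> y; have := hs y; rewrite set_nil setU0; exact: lspan_id.
apply: IH; set V := lspan _; have hV : submodule V := lspan_submodule _.
have [V0 VD VZ VB] := submodule_lin hV.
have dec y : exists r : R, V (y - r *: x).
  by apply: lspan_cons; rewrite setUCA -set_seq_cons; apply: hs.
(* Since [M = V + R x], the submodule [J M] lies in [V + J x]. *)
have [j [hj xj]] : exists j, jacobson j /\ V (x - j *: x).
  move: (hJ x); apply: (lspan_min (U := [set y | exists j, jacobson j /\ V (y - j *: x)])).
    split=> [|a y z [j [hj Vj]] [k [hk Vk]]].
      by exists 0; rewrite scale0r subr0; split=> //; exact: jacobson0.
    exists (a * j + k); split.
      rewrite -[k]opprK -[- k]add0r; apply: jacobsonB; first exact: jacobsonMl.
      by apply: jacobsonB => //; exact: jacobson0.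
    by rewrite scalerDl -scalerA opprD addrACA -scalerBr; apply: VD => //; apply: VZ.
  move=> y [Uy|[a [m [ha ->]]]].
    exists 0; split; first exact: jacobson0.
    by rewrite scale0r subr0; apply: sub_lspan; left.
  have [r hr] := dec m; exists (a * r); split; first exact: jacobsonMr.
  by rewrite -scalerA -scalerBr; apply: VZ.
have [u hu] := jacobson_left_inv hj.
have Vx : V x.
  by rewrite -[x]scale1r -hu -scalerA scalerBl scale1r; apply: VZ.
by move=> y; have [r hr] := dec y; rewrite -(subrK (r *: x) y); apply: VD => //; apply: VZ.
Qed.

(** If [a M] is not inside [U], then [M = U + J M] gives some [b] in [J] with [a b M] not inside
    [U]. Iterating from [a = 1] produces a sequence in [J] with no vanishing product. *)
Lemma T_nilpotent_nakayama M : left_T_nilpotent (@jacobson R) -> nakayama M.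
Proof.
move=> hT U hU hJ y; apply: contrapT => hy.
have [U0 UD UZ UB] := submodule_lin hU.
pose P (a : R) := exists m : M, ~ U (a *: m).
have /choice[g hg] : forall a, exists b, P a -> jacobson b /\ P (a * b).
  move=> a; have [[m hm]|nP] := pselect (P a); last by exists 0.
  apply: contrapT => hn; apply: hm; rewrite -[a]mulr1.
  (* The arbitrary factor [r] makes the condition on [m] stable under scalars. *)
  have : forall r, U ((a * r) *: m).
    move: (hJ m); apply: (lspan_min (U := [set y | forall r, U ((a * r) *: y)])).
      split=> [r|c z w hz hw r]; first by rewrite scaler0.
      by rewrite scalerDr scalerA -mulrA; apply: UD; [exact: hz | exact: hw].
    move=> z [Uz|[b [m' [hb ->]]]] r; first exact: UZ.
    apply: contrapT => nU; apply: hn; exists (r * b) => _; split; first exact: jacobsonMl.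
    by exists m'; rewrite mulrA -scalerA.
  exact.
pose A := fix A n := if n is n'.+1 then A n' * g (A n') else 1.
have PA n : P (A n).
  by elim: n => [|n IH] /=; [exists y; rewrite scale1r | case: (hg _ IH)].
have [n [_ hn]] := hT (fun i => g (A i)) (fun i => (hg _ (PA i)).1).
have AE k : A k = \prod_(0 <= i < k) g (A i).
  by elim: k => [|k IH] /=; rewrite ?big_nil // big_nat_recr //= -IH.
by have [m] := PA n; rewrite AE hn scale0r.
Qed.

End Span.

(** * Finite generation over a left noetherian ring *)

Section Noetherian.
Variable R : pzRingType.
Hypothesis hR : left_noetherian R.

Lemma noetherian_ideal_fg (I : set R^o) : submodule I ->
  exists s : seq R^o, forall y, I y <-> lspan [set` s] y.
Proof.
move=> hI; apply: contrapT => hn.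
have /choice[g hg] : forall s : seq R^o, exists x : R^o, (forall t, t \in s -> I t) ->
    I x /\ ~ lspan [set` s] x.
  move=> s; have [hs|hs] := pselect (forall t, t \in s -> I t); last by exists 0.
  apply: contrapT => hx; apply: hn; exists s => y; split=> [Iy|].
    by apply: contrapT => ny; apply: hx; exists y.
  exact: lspan_min.
pose S := fix S n := if n is n'.+1 then g (S n') :: S n' else [::].
have SI n : forall t, t \in S n -> I t.
  elim: n => // n IH t; rewrite inE => /orP[/eqP->|]; last exact: IH.
  by case: (hg _ IH).
have [|n|N hN] := hR (I := fun n => lspan [set` S n]).
- by move=> n; exact: lspan_submodule.
- apply: (@lspan_sub _ _ [set` S n] [set` S n.+1]) => x hx.
  by apply: sub_lspan; rewrite /= inE hx orbT.
- have [_] := hg _ (SI N); apply.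
  rewrite -(hN N.+1) //; apply: sub_lspan; exact: mem_head.
Qed.

(** With [V] the span of the remaining generators, the coefficients of [x] in elements of [U] modulo
    [V] form a left ideal. Lifts of its generators, together with generators of [U] meet [V],
    generate [U]. *)
Lemma noetherian_submodule_fg (M : lmodType R) (s : seq M) (U : set M) :
  submodule U -> U `<=` lspan [set` s] ->
  exists t : seq M, forall y, U y <-> lspan [set` t] y.
Proof.
elim: s U => [|x s IH] U hU Us.
  by exists [::] => y; split=> [/Us//|]; apply: lspan_min => // z.
have [U0 UD UZ UB] := submodule_lin hU.
have hV := lspan_submodule [set` s]; have [V0 VD VZ VB] := submodule_lin hV.
set V := lspan [set` s] in hV V0 VD VZ VB.
have [|rs hrs] := @noetherian_ideal_fg [set r | exists2 u, U u & V (u - (r : R) *: x)].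
  split=> [|a r r' [u Uu Vu] [v Uv Vv]]; first by exists 0 => //; rewrite scale0r subr0.
  exists (a *: u + v); first exact: hU.2.
  by rewrite scalerDl -scalerA opprD addrACA -scalerBr; apply: VD => //; apply: VZ.
have [|y [_ Vy]//|t ht] := IH (U `&` V).
  by split=> // a y z [Uy Vy] [Uz Vz]; split; [apply: hU.2 | apply: hV.2].
have [us [hus1 hus2]] : exists us : seq M, {in us, forall u, U u} /\
    forall r : R, lspan [set` rs] (r : R^o) -> exists2 u, lspan [set` us] u & V (u - r *: x).
  have hrs' r : r \in rs -> exists2 u, U u & V (u - (r : R) *: x).
    by move=> rrs; apply/hrs; exact: sub_lspan.
  elim: rs hrs' {hrs} => [|r rs IHrs] hrs.
    exists [::]; split=> // r hr; exists 0; first by case: (lspan_submodule [set` [::] : seq M]).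
    have -> : r = 0.
      apply: (lspan_min (U := [set x : R^o | x = 0]) _ _ hr) => //.
      exact: submodule_set0.
    by rewrite scale0r subr0.
  have [q hq|us [h1 h2]] := IHrs; first by apply: hrs; rewrite inE hq orbT.
  have [u Uu Vu] := hrs r (mem_head _ _); exists (u :: us); split.
    by move=> v; rewrite inE => /orP[/eqP->//|]; exact: h1.
  move=> q; rewrite set_seq_cons => /lspan_cons[c /h2[v hv Vv]].
  have hS := lspan_submodule [set` u :: us].
  exists (c *: u + v).
    apply: hS.2; first by apply: sub_lspan; exact: mem_head.
    by apply: lspan_sub hv => w hw; apply: sub_lspan; rewrite /= inE hw orbT.
  rewrite (_ : _ - _ = c *: (u - (r : R) *: x) + (v - (q - c * (r : R)) *: x)); first exact: hV.2.
  by rewrite scalerBr scalerBl scalerA opprB addrACA addKr.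
exists (us ++ t) => y; split=> [Uy|]; last first.
  apply: lspan_min => // z; rewrite /= mem_cat => /orP[/hus1//|zt].
  by have /ht[] : lspan [set` t] z by exact: sub_lspan.
have hS := lspan_submodule [set` us ++ t]; have [S0 SD SZ SB] := submodule_lin hS.
have [r Vr] : exists r : R, V (y - r *: x) by apply: lspan_cons; rewrite -set_seq_cons; apply: Us.
have [|u hu Vu] := hus2 r; first by apply/hrs; exists y.
rewrite -(subrK u y); apply: SD.
  have : lspan [set` t] (y - u).
    apply/ht; split.
      apply: UB => //; exact: (lspan_min hU hus1 hu).
    have -> : y - u = (y - r *: x) - (u - r *: x) by rewrite opprB addrA subrK.
    exact: VB.
  by apply: lspan_sub => z hz; apply: sub_lspan; rewrite /= mem_cat hz orbT.
by apply: lspan_sub hu => z hz; apply: sub_lspan; rewrite /= mem_cat hz.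
Qed.

End Noetherian.

(** * Idempotents modulo the radical *)

Lemma lspan_finite (R : pzRingType) (M : lmodType R) (G : set M) (y : M) :
  lspan G y -> exists s : seq M, (forall x, x \in s -> G x) /\ lspan [set` s] y.
Proof.
apply: (lspan_min (U := [set y | exists s : seq M,
  (forall x, x \in s -> G x) /\ lspan [set` s] y])) => [|x Gx].
  split=> [|a u v [s [sG hs]] [t [tG ht]]].
    by exists [::]; split=> //; case: (lspan_submodule [set` [::] : seq M]).
  exists (s ++ t); split=> [x|]; first by rewrite mem_cat => /orP[/sG|/tG].
  apply: (lspan_submodule _).2.
    by apply: lspan_sub hs => x hx; apply: sub_lspan; rewrite /= mem_cat hx.
  by apply: lspan_sub ht => x hx; apply: sub_lspan; rewrite /= mem_cat hx orbT.
exists [:: x]; split=> [z|]; first by rewrite inE => /eqP->.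
by apply: sub_lspan; rewrite /= mem_head.
Qed.

(** [S u] is zero or a minimal left ideal. *)
Definition minimal_idem (S : pzRingType) (u : S) : Prop :=
  u * u = u /\ forall r : S, r * u <> 0 -> exists a, u = a * (r * u).

(* A complement of a maximal left ideal containing all minimal idempotents
   would be generated by one more of them. *)
Lemma semisimple_minimal_idem (S : pzRingType) : semisimple_ring S ->
  lspan (@minimal_idem S : set S^o) 1.
Proof.
move=> hS; apply: contrapT => h1.
have [|m [[hm mT mmax] Gm]] := maximal_left_ideal_ex (L := lspan (@minimal_idem S : set S^o)) _ h1.
  exact: lspan_submodule.
have [V [hV mV dec]] := hS m hm.
have [_ _ VZ VB] := submodule_lin hV; have [_ mD mZ mB] := submodule_lin hm.
have mV0 x : m x -> V x -> x = 0.
  by move=> mx Vx; have : (m `&` V) x by []; rewrite mV.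
have [w [u [mw Vu e1]]] := dec 1.
have vu (v : S^o) : V v -> v = v * u.
  move=> Vv; apply/eqP; rewrite -subr_eq0; apply/eqP; apply: mV0; last first.
    by apply: VB => //; apply: (VZ v).
  have -> : v - v * u = v * w by rewrite -{1}[v]mulr1 e1 mulrDr addrK.
  exact: (mZ v).
have Gu : minimal_idem u.
  split=> [|r ru]; first by rewrite -vu.
  have Vru : V (r * u) by apply: (VZ r).
  pose L := [set x : S^o | exists a, m (x - a * (r * u))].
  have hL : left_ideal L.
    split=> [|c x y [a ha] [b hb]]; first by exists 0; rewrite mul0r subr0; case: hm.
    exists (c * a + b); rewrite mulrDl opprD addrACA -mulrA.
    apply: mD => //; rewrite (_ : _ - _ = c *: (x - a * (r * u) : S^o)); first exact: mZ.
    by rewrite scalerBr.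
  have [|Lm|LT] := mmax L hL.
  - by move=> x mx; exists 0; rewrite mul0r subr0.
  - exfalso; apply: ru; apply: mV0 => //; rewrite -Lm; exists 1.
    by rewrite mul1r subrr; case: hm.
  - have [a ha] : L u by rewrite LT.
    exists a; apply/eqP; rewrite -subr_eq0; apply/eqP; apply: mV0 => //.
    by apply: VB => //; apply: (VZ a).
apply: mT; rewrite predeqE => x; split=> // _; rewrite -[x]mulr1 e1.
by apply: (mZ x); apply: mD => //; apply: Gm; exact: sub_lspan.
Qed.

Section Lifting.
Variable R : pzRingType.

Lemma jproj0 : jproj (0 : R) = 0.
Proof. by apply: (addrI (jproj (0 : R))); rewrite -jprojD !addr0. Qed.

Lemma jproj_eq0 (x : R) : jproj x = 0 <-> jacobson x.
Proof. by rewrite -jproj0 jproj_eq subr0. Qed.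

Lemma jproj_mul (x y : R) : jproj (x * y) = jproj x * jproj y.
Proof. by rewrite -jprojM. Qed.

Lemma jprojX (x : R) n : jproj (x ^+ n) = jproj x ^+ n.
Proof. by elim: n => // n IH; rewrite !exprS jproj_mul IH. Qed.

Lemma idem_expr (S : pzRingType) (x : S) n : x * x = x -> x ^+ n.+1 = x.
Proof. by move=> h; elim: n => // n IH; rewrite exprS IH. Qed.

(* If [(x - x^2)^n = 0] then [x^n = x^(n+1) q] with [q] commuting with [x], and
   [x^n q^n] is an idempotent congruent to [x]. *)
Lemma T_nilpotent_idempotents_lift :
  left_T_nilpotent (@jacobson R) -> idempotents_lift R.
Proof.
move=> hT y hy; have [x xy] := jproj_surj y; rewrite -xy -jproj_mul in hy.
have hx : jacobson (x * (1 - x)).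
  by apply/jproj_eq0; rewrite mulrBr mulr1; apply/jproj_eq0/jproj_eq.
have [n [n0 hn]] := hT (fun=> x * (1 - x)) (fun=> hx).
have c1 : GRing.comm x (1 - x) by apply: commrB => //; exact: commr1.
have {}hn : x ^+ n * (1 - x) ^+ n = 0.
  by rewrite -exprMn_comm // -hn big_const_nat subn0; elim: (n) => //= k <-; rewrite exprS.
have [q [cq hq]] : exists q, GRing.comm x q /\ (1 - x) ^+ n = 1 - x * q.
  elim: (n) => [|k [q [cq IH]]]; first by exists 0; rewrite mulr0 subr0; split=> //; exact: commr0.
  exists (q + (1 - x * q)); split.
    apply: commrD => //; apply: commrB; first exact: commr1.
    exact: commrM.
  by rewrite exprS IH mulrBl mul1r (mulrDr x q) opprD addrA.
have xn : x ^+ n = x ^+ n.+1 * q.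
  by move: hn; rewrite hq mulrBr mulr1 mulrA -exprSr => /eqP; rewrite subr_eq0 => /eqP.
have xnk k : x ^+ n = x ^+ (n + k) * q ^+ k.
  elim: k => [|k IH]; first by rewrite addn0 expr0 mulr1.
  rewrite {1}IH addnC exprD {1}xn mulrA -exprD -[in LHS]mulrA -exprS.
  by rewrite (addnC k) addSnnS.
have cc : q ^+ n * x ^+ n = x ^+ n * q ^+ n.
  by apply/commrX/commr_sym/commrX.
exists (x ^+ n * q ^+ n); split.
  rewrite mulrA -(mulrA (x ^+ n) (q ^+ n) (x ^+ n)) cc (mulrA (x ^+ n)).
  by rewrite -(exprD x n n) -xnk.
rewrite -xy jproj_mul !jprojX; set X := jproj x; set Q := jproj q.
have XX : X * X = X by rewrite -jproj_mul.
have XQ : X = X * Q.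
  have := congr1 (@jproj R) xn; rewrite jproj_mul !jprojX -/X -/Q -(prednK n0).
  by rewrite !idem_expr.
rewrite -(prednK n0) idem_expr //.
by elim: n.-1.+1 => [|k IH]; rewrite ?mulr1 // exprS mulrA -XQ.
Qed.

(** [R e] modulo [J e] is zero or simple. *)
Definition local_idem (e : R) : Prop :=
  e * e = e /\ forall r, ~ jacobson (r * e) -> exists a, jacobson (e - a * (r * e)).

(** The minimal idempotents of [R / J] are lifted one by one, without orthogonality; redundancy
    among them is removed later by independence. *)
Lemma semiperfect_local_idem : semiperfect R -> exists es : seq R,
  (forall e, e \in es -> local_idem e) /\
  lspan ([set` es] `|` @jacobson R : set R^o) 1.
Proof.
move=> [hS hL].
have [us [hus us1]] := lspan_finite (semisimple_minimal_idem hS).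
have lift u : minimal_idem u -> exists e : R, local_idem e /\ jproj e = u.
  move=> [uu hu]; have [e [ee eu]] := hL u uu; exists e; split=> //; split=> // r hr.
  have [|a ha] := hu (jproj r).
    by rewrite -eu -jproj_mul => /jproj_eq0.
  have [b hb] := jproj_surj a; exists b; apply/jproj_eq.
  by rewrite !jproj_mul hb eu.
have [es [hes1 hes2]] : exists es : seq R, (forall e, e \in es -> local_idem e) /\
    forall u, u \in us -> exists2 e, e \in es & jproj e = u.
  elim: us hus {us1} => [|u us IH] hus; first by exists [::].
  have [v hv|es [h1 h2]] := IH; first by apply: hus; rewrite inE hv orbT.
  have [|e [he eu]] := lift u; first by apply: hus; exact: mem_head.
  exists (e :: es); split=> [e'|v]; rewrite inE => /orP[/eqP->|] //.
  - exact: h1.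
  - by exists e => //; exact: mem_head.
  - by move=> /h2[e' he' <-]; exists e' => //; rewrite inE he' orbT.
exists es; split=> //; set G := _ `|` _.
have [G0 GD GZ GB] := submodule_lin (lspan_submodule (G : set R^o)).
have GJ (x : R^o) : jacobson (x : R) -> lspan (G : set R^o) x.
  by move=> hx; apply: sub_lspan; right.
(* Quantifying over all lifts absorbs the radical, which is part of [G]. *)
suff : [set y : (jquot R)^o | forall x : R, jproj x = y -> lspan (G : set R^o) x] 1.
  exact.
move: us1; apply: lspan_min => [|u hu x xu].
  split=> [x|a y z hy hz x hx]; first by move=> /jproj_eq0; apply: GJ.
  have [a' aE] := jproj_surj a; have [y' yE] := jproj_surj y; have [z' zE] := jproj_surj z.
  rewrite -(subrK (a' * y' + z' : R^o) x).
  apply: (GD _ _ _ (GD _ _ (GZ a' _ (hy _ yE)) (hz _ zE))).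
  apply: GJ; apply/(jproj_eq x (a' * y' + z')); apply: (etrans hx).
  by rewrite jprojD jproj_mul aE yE zE.
have [e he eu] := hes2 u hu; rewrite -(subrK (e : R^o) x); apply: GD.
  by apply: GJ; apply/(jproj_eq x e); exact: etrans xu (esym eu).
by apply: sub_lspan; left.
Qed.
End Lifting.

(** * Projective covers *)

(** The alternative [s = [::]] is there because the chain may be empty. *)
Lemma chain_seq (T : eqType) (F : set (set T)) (s : seq T) :
  total_on F subset -> (forall t, t \in s -> exists2 A, F A & A t) ->
  s = [::] \/ exists2 A, F A & forall t, t \in s -> A t.
Proof.
move=> Ftot; elim: s => [|t s IH] hs; first by left.
right; have [A FA At] := hs t (mem_head _ _).
have [u us||[B FB Bs]] := IH; first by apply: hs; rewrite inE us orbT.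
  by move=> ->; exists A => // u; rewrite inE => /eqP->.
have [AB|BA] := Ftot _ _ FA FB; [exists B => // | exists A => //] => u;
  rewrite inE => /orP[/eqP->|/Bs] //; [exact: AB | exact: BA].
Qed.

Section Cover.
Variables (R : pzRingType) (M : lmodType R) (S0 : set (R * M)).
Hypothesis hS0 : forall t, S0 t -> local_idem t.1.
Hypothesis gen : forall y, lspan ([set x | exists2 t, S0 t & x = t.1 *: t.2] `|` @jac_gen R M) y.
Hypothesis nakM : nakayama M.

Let T : choiceType := (R * M)%type.
Let xT (t : T) : M := t.1 *: t.2.
Let JM : set M := lspan (@jac_gen R M).

(* The elements [e m], [(e, m) \in S], are independent in [M / JM], up to those
   in [JM]. *)
Definition indep (S : set T) : Prop := S `<=` S0 /\
  forall z : free_mod R T, (forall t, ~ S t -> fcoef z t = 0) ->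
    (forall t, fcoef z t * t.1 = fcoef z t) ->
    JM (fev xT z) -> forall t, jacobson (fcoef z t).

(** Independence is of finite character: the support of [z] is finite, so it lies in one member of
    the chain unless [z] vanishes. *)
Lemma indep_max : exists S, indep S /\ forall S', S `<` S' -> ~ indep S'.
Proof.
apply: Zorn_bigcup => F FI Ftot; split=> [t [A FA At]|z z0 ze zJ t].
  exact: (FI _ FA).1.
have [s [us hs]] := fcoefP z.
pose s' := [seq t <- s | fcoef z t != 0].
have [||[A FA As]] := @chain_seq T F s' Ftot.
- move=> u; rewrite mem_filter => /andP[/eqP zu _]; apply: contrapT => hn.
  by apply: zu; apply: z0 => -[A FA Au]; apply: hn; exists A.
- move=> s'0; have -> : fcoef z t = 0; last exact: jacobson0.
  have [ts|/hs//] := boolP (t \in s); apply/eqP; apply: contraT => zt.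
  by have : t \in s' by [rewrite mem_filter zt]; rewrite s'0.
- apply: (FI _ FA).2 => // u nAu; apply/eqP; apply: contraT => zu.
  exfalso; apply: nAu; apply: As; rewrite mem_filter zu /=.
  by apply: contraT => /hs zu0; rewrite zu0 eqxx in zu.
Qed.

(** For a maximal independent [S], the sum of the [R e] over [(e, m)] in [S] maps to [M] by sending
    the generator [e] to [e m]. Independence puts the kernel in the radical; maximality makes the
    image all of [M] modulo [J M], and Nakayama gives surjectivity. *)
Lemma cover_ex : exists (P : lmodType R) (p : {linear P -> M}),
  [/\ projective P, forall y, exists x, p x = y,
      forall z, p z = 0 -> lspan (@jac_gen R P) z &
      forall s : seq (R * M), S0 `<=` [set` s] -> finitely_generated P].
Proof.
have [S [[SS0 Sind] Smax]] := indep_max.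
(* The idempotent 0 outside [S] realises the sum over [S] inside the free module on all of [T]. *)
pose e (t : T) : R := if pselect (S t) then t.1 else 0.
have eS t : S t -> e t = t.1 by rewrite /e; case: pselect.
have enS t : ~ S t -> e t = 0 by rewrite /e; case: pselect.
have he t : e t * e t = e t.
  have [St|nS] := pselect (S t); last by rewrite enS // mulr0.
  by rewrite eS //; case: (hS0 (SS0 _ St)).
have [P [j [ij hj]]] := submodule_ex (idem_free_submodule e).
have hP : projective P by exact: idem_free_projective he _ _ ij hj.
have jP v : idem_free e (j v) by apply/hj; exists v.
pose p : {linear P -> M} := fev xT \o j.
have [JM0 JMD JMZ JMB] := submodule_lin (lspan_submodule (@jac_gen R M)).
have coefS v t : ~ S t -> fcoef (j v) t = 0 by move=> nS; rewrite -jP enS // mulr0.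
have coefe v t : fcoef (j v) t * t.1 = fcoef (j v) t.
  have [St|nS] := pselect (S t); last by rewrite coefS // mul0r.
  by rewrite -{1}(eS _ St) jP.
have pJ v : JM (p v) -> lspan (@jac_gen R P) v.
  move=> hv; have hc t : jacobson (fcoef (j v) t).
    exact: (Sind (j v) (coefS v) (coefe v) hv).
  have [s hs] := fcoefP (j v).
  have /choice[d hd] : forall t, exists d, j d = fdelta t (e t).
    by move=> t; apply/hj; rewrite -[e t]mul1r; exact: idem_free_delta.
  have -> : v = \sum_(t <- s) fcoef (j v) t *: d t.
    apply: ij; rewrite linear_sum /= {1}(idem_free_sum (jP v) hs).
    by apply: eq_bigr => t _; rewrite linearZ /= hd.
  apply: submodule_sum => [|t _]; first exact: lspan_submodule.
  by apply: sub_lspan; exists (fcoef (j v) t), (d t).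
have [I0 ID IZ IB] := submodule_lin (lspan_submodule (range p `|` @jac_gen R M)).
set I := lspan _ in I0 ID IZ IB.
have pI v : I (p v) by apply: sub_lspan; left; exists v.
have JI y : JM y -> I y by apply: lspan_sub => x hx; apply: sub_lspan; right.
have sub_img : submodule (range p).
  split=> [|a _ _ [v _ <-] [w _ <-]]; first by exists 0 => //; rewrite linear0.
  by exists (a *: v + w) => //; rewrite linearP.
have genI t : S0 t -> I (xT t).
  move=> S0t; have [St|nS] := pselect (S t).
    have [v hv] : exists v, j v = fdelta t (e t).
      by apply/hj; rewrite -[e t]mul1r; exact: idem_free_delta.
    have -> : xT t = p v by rewrite /= hv fev_delta eS // /xT scalerA (hS0 S0t).1.
    exact: pI.
  have : ~ indep (t |` S).
    by apply: Smax; split=> [u Su|h]; [right | apply: nS; apply: h; left].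
  (* If [xT t] were outside the image modulo [J M], adding [t] to [S] would preserve independence,
     against maximality. *)
  apply: contra_notP => nI; split=> [u [->//|/SS0//]|z zS ze zJ].
  pose w := z - fdelta t (fcoef z t).
  have zt0 : fcoef w t = 0 by rewrite fcoefB fdeltaE eqxx subrr.
  have wS u : ~ S u -> fcoef w u = 0.
    move=> nSu; have [->//|ut] := eqVneq u t; rewrite fcoefB fdeltaE (negPf ut) subr0.
    by apply: zS => -[ut'|//]; rewrite ut' eqxx in ut.
  have we u : fcoef w u * u.1 = fcoef w u.
    rewrite fcoefB mulrBl ze fdeltaE; case: eqP => [->|_]; last by rewrite mul0r.
    by rewrite ze.
  have wE : fev xT w = fev xT z - fcoef z t *: xT t by rewrite linearB /= fev_delta.
  have [ztJ|ztJ] := pselect (jacobson (fcoef z t)).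
    have wJ : JM (fev xT w).
      rewrite wE; apply: JMB => //; apply: sub_lspan.
      by exists (fcoef z t), (xT t).
    move=> u; have := Sind w wS we wJ u; rewrite fcoefB fdeltaE.
    by case: eqP => [->//|_]; rewrite subr0.
  (* The coefficient [z_t] is outside [J], so locality gives [a] with [t.1 - a z_t] in [J]. Hence
     [xT t] is [a z_t xT t] modulo [J M], and [z_t xT t] is the difference of the values of [z] and
     [w], both in [I]. *)
  exfalso; apply: nI.
  have [_ /(_ (fcoef z t))] := hS0 S0t; rewrite ze => -/(_ ztJ)[a ha].
  have -> : xT t = (t.1 - a * fcoef z t) *: xT t + a *: (fcoef z t *: xT t).
    by rewrite (scalerA a) -scalerDl subrK /xT scalerA (hS0 S0t).1.
  apply: ID; first by apply: JI; apply: sub_lspan; exists (t.1 - a * fcoef z t), (xT t).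
  apply: IZ; have -> : fcoef z t *: xT t = fev xT z - fev xT w by rewrite wE opprB addrC subrK.
  apply: IB; first exact: JI.
  have [v hv] : exists v, j v = w.
    apply/hj => u; have [Su|nSu] := pselect (S u); last by rewrite wS // mul0r.
    by rewrite eS.
  by rewrite -hv; exact: pI.
exists P, p; split=> // [y|z hz|s S0s].
- suff [v _ <-] : range p y by exists v.
  apply: nakM => // {}y; apply: lspan_sub (gen y) => x [[t S0t ->]|hx].
    exact: genI.
  by apply: sub_lspan; right.
- by apply: pJ; rewrite hz.
- have /choice[d hd] : forall t, exists d, j d = fdelta t (e t).
    by move=> t; apply/hj; rewrite -[e t]mul1r; exact: idem_free_delta.
  apply/finitely_generatedP; exists (map d s) => v.
  have [q [uq hq]] := fcoefP (j v).
  have -> : v = \sum_(t <- q) fcoef (j v) t *: d t.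
    apply: ij; rewrite linear_sum /= {1}(idem_free_sum (jP v) (conj uq hq)).
    by apply: eq_bigr => t _; rewrite linearZ /= hd.
  have [W0 _ WZ _] := submodule_lin (lspan_submodule [set` map d s]).
  apply: submodule_sum => [|t _]; first exact: lspan_submodule.
  have [St|nS] := pselect (S t); last by rewrite coefS // scale0r.
  by apply: WZ; apply: sub_lspan; apply: map_f; apply: S0s; exact: SS0.
Qed.
End Cover.

Section CoverClasses.
Variable R : pzRingType.

(** Requiring [D] of the kernel as well lets covers be iterated into a minimal resolution. *)
Definition has_cover (D : lmodType R -> Prop) (M : lmodType R) : Prop :=
  exists (K P : lmodType R) (i : {linear K -> P}) (p : {linear P -> M}),
    [/\ ses i p, projective P, forall k, lspan (@jac_gen R P) (i k), D P & D K].

Lemma local_idem_gen (es : seq R) (M : lmodType R) (G : set M) :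
  lspan ([set` es] `|` @jacobson R : set R^o) 1 -> (forall y, lspan G y) ->
  forall y, lspan ([set x | exists2 t : R * M, t.1 \in es /\ G t.2 & x = t.1 *: t.2]
    `|` @jac_gen R M) y.
Proof.
move=> h1 hG y; set H := _ `|` _.
have [H0 HD HZ HB] := submodule_lin (lspan_submodule H).
apply: lspan_sub (hG y) => m Gm; rewrite -[m]scale1r.
move: h1; apply: (lspan_min (U := [set r : R^o | lspan H ((r : R) *: m)])).
  split=> [|a r r' hr hr']; first by rewrite /= scale0r.
  by rewrite /= scalerDl; apply: (HD) => //; rewrite -scalerA; exact: HZ.
move=> r [res|rJ]; apply: sub_lspan; first by left; exists (r, m).
by right; exists r, m.
Qed.

Lemma noetherian_cover (M : lmodType R) : left_noetherian R -> semiperfect R ->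
  finitely_generated M -> has_cover (@finitely_generated R) M.
Proof.
move=> hN hS fM; have nM := finitely_generated_nakayama fM.
have [es [hes es1]] := semiperfect_local_idem hS.
have [s hs] := (finitely_generatedP M).1 fM.
have [|P [p [hP sp pJ fP]]] := cover_ex (S0 := [set t : R * M | t.1 \in es /\ t.2 \in s]) _
  (local_idem_gen es1 hs) nM; first by move=> t [/hes].
have {}fP : finitely_generated P.
  apply: (fP [seq (e, m) | e <- es, m <- s]) => -[e m] [/= ? ?].
  exact: allpairs_f.
have [K [i S]] := ses_kernel sp; have [ii _ ex] := S.
exists K, P, i, p; split=> // [k|]; first by apply: pJ; apply: ses_comp0 S.
have [q hq] := (finitely_generatedP P).1 fP.
have [t ht] := noetherian_submodule_fg hN (submodule_ker p) (fun x _ => hq x).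
apply/finitely_generatedP.
have hti x : x \in t -> exists k, i k = x.
  by move=> xt; apply/ex; apply/ht; exact: sub_lspan.
have [t' ht'] : exists t' : seq K, map i t' = t.
  elim: t {ht} hti => [|x t IH] h; first by exists [::].
  have [y yt|t' <-] := IH; first by apply: h; rewrite inE yt orbT.
  by have [k <-] := h x (mem_head _ _); exists (k :: t').
exists t' => k; have : lspan [set` t] (i k) by apply/ht; apply: ses_comp0 S.
suff H : lspan [set` t] `<=` [set x | exists2 l, lspan [set` t'] l & i l = x].
  by move=> /H[l hl /ii <-].
apply: lspan_min => [|x].
  have hs' := lspan_submodule [set` t'].
  split=> [|a _ _ [l hl <-] [l' hl' <-]]; first by exists 0; [case: hs' | rewrite linear0].
  by exists (a *: l + l'); [exact: hs'.2 | rewrite linearP].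
by rewrite -ht' => /mapP[l lt ->]; exists l => //; exact: sub_lspan.
Qed.

Lemma perfect_cover (M : lmodType R) : left_perfect R -> has_cover (fun _ => True) M.
Proof.
move=> [hS hT]; have nM := T_nilpotent_nakayama (M := M) hT.
have [es [hes es1]] := semiperfect_local_idem (conj hS (T_nilpotent_idempotents_lift hT)).
have hG (y : M) : lspan setT y by exact: sub_lspan.
have [|P [p [hP sp pJ _]]] := cover_ex (S0 := [set t : R * M | t.1 \in es /\ setT t.2]) _
  (local_idem_gen es1 hG) nM; first by move=> t [/hes].
have [K [i S]] := ses_kernel sp.
exists K, P, i, p; split=> // k; apply: pJ; exact: ses_comp0 S.
Qed.
End CoverClasses.

(** * Minimal resolutions and extension of scalars *)

Section Syzygies.
Variables (A : pzRingType) (D : lmodType A -> Prop).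
Implicit Types M N K P L : lmodType A.

(* [K] is the [n]-th syzygy of [M] in some minimal projective resolution: each
   syzygy lies in the radical of the projective module it embeds into. *)
Fixpoint syz M (n : nat) K : Prop :=
  if n is m.+1 then
    exists N P (i : {linear K -> P}) (p : {linear P -> N}),
      [/\ syz M m N, ses i p, projective P, forall k, lspan (@jac_gen A P) (i k) & D P /\ D K]
  else D M /\ M = K.

Lemma syz_D M n K : syz M n K -> D K.
Proof. by case: n => [[? <-]|n [N [P [i [p [_ _ _ _ []]]]]]]. Qed.

Lemma syz_ex M n : (forall M', D M' -> has_cover D M') -> D M -> exists K, syz M n K.
Proof.
move=> hD hM; elim: n => [|n [N hN]]; first by exists M.
have [K [P [i [p [S hP hi DP DK]]]]] := hD N (syz_D hN).
by exists K, N, P, i, p.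
Qed.

Lemma syz_trans M d K j L : syz M d K -> syz K j L -> syz M (d + j) L.
Proof.
move=> hK; elim: j L => [|j IH] L; first by rewrite addn0 => -[_ <-].
by rewrite addnS => -[N [P [i [p [/IH hN S hP hi DK]]]]]; exists N, P, i, p.
Qed.

Lemma syz_pdle_up m M n K : syz M n K -> pdle m K -> pdle (m + n) M.
Proof.
elim: n m K => [|n IH] m K; first by move=> [_ <-]; rewrite addn0.
move=> [N [P [i [p [hN S hP _ _]]]]] hK; rewrite addnS -addSn; apply: IH hN _.
by exists K, P, i, p.
Qed.

(** Truncated subtraction is intended: after a projective syzygy all later ones are projective. *)
Lemma syz_pdle_down m M n K : syz M n K -> pdle m M -> pdle (m - n) K.
Proof.
move=> + hM; elim: n K => [|n IH] K; first by move=> [_ <-]; rewrite subn0.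
move=> [N [P [i [p [/IH hN S hP _ _]]]]]; rewrite subnS; exact: pdle_syzygy S hP hN.
Qed.

(* Dimension shifting along a flat resolution of [X]: [Tor_1(X, N) = 0]. *)
Lemma tor_syz (X : lmodType A^c) d n M N K P (i : {linear K -> P}) (p : {linear P -> N}) :
  cdle (@flat A) d X -> (d <= n)%N -> syz M n N -> ses i p ->
  forall z : tensor X K, tmap idfun i z = 0 -> z = 0.
Proof.
elim: d X n N K P i p => [|d IH] X n N K P i p.
  move=> [F [f [fi fs hF]]] _ _ [ii _ _] z; apply: flat_tmap ii.
  exact: flat_iso fi fs hF.
move=> [X' [F [j [q [Sj hF hX']]]]]; case: n => // n dn.
move=> [N0 [P0 [i0 [p0 [hN0 S0 hP0 _ _]]]]] S; have [ij _ _] := Sj.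
(* As a syzygy, [N] embeds in the projective [P0]. Injectivity of [X' (x) N -> F (x) N] follows from
   that of [X' (x) N -> X' (x) P0], by induction, and of [X' (x) P0 -> F (x) P0]. *)
apply: (tor_shift Sj S hF) => z hz.
apply: (IH _ _ _ _ _ _ _ hX' dn hN0 S0).
apply: (projective_tmap hP0 ij); rewrite (tmap_comp (g := j) (k := i0)) //.
by rewrite -(tmap_comp (h := j) (f := idfun) (h' := idfun) (f' := i0)) // hz raddf0.
Qed.

End Syzygies.

(** * Minimal syzygies under extension of scalars *)

Section Core.
Variables (A B : pzRingType) (phi : {rmorphism A -> B}).
Hypotheses (hrad : radical_preserving phi) (hker : superfluous_kernel phi).
Local Notation ext := (ext phi).
Local Notation ext_map := (ext_map phi).
Implicit Types M N K P : lmodType A.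

(** [b (x) a m] equals [b phi(a) (1 (x) m)], with [phi(a)] in the radical of [B]. The induction
    keeps [b] arbitrary since scalars of [A] are absorbed into it. *)
Lemma ext_radical K P (i : {linear K -> P}) :
  (forall k, lspan (@jac_gen A P) (i k)) ->
  forall z, lspan (@jac_gen B (ext P)) (ext_map i z).
Proof.
have [G0 GD GZ GB] := submodule_lin (lspan_submodule (@jac_gen B (ext P))).
move=> hi; apply: ext_ind => [b k|x y hx hy]; last by rewrite raddfB; apply: GB.
rewrite ext_map_tens; move: (i k) (hi k) b.
apply: (lspan_min (U := [set x | forall b, lspan (@jac_gen B (ext P)) (etens phi b x)])) => [|x].
  split=> [c|a x y hx hy c]; first by rewrite etens0.
  by rewrite etensDr -etens_bal; apply: (GD).
move=> [a [m [ha ->]]] c; rewrite -etens_bal -[_ * _]mulr1 -etensZ.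
apply: sub_lspan; exists (c * phi a), (etens phi 1 m); split=> //.
by apply: jacobsonMl; apply: hrad; exists a.
Qed.

(** From [1 (x) x = 0], [phi] kills every dual coordinate of [x], so these coordinates lie in the
    radical of [A]. *)
Lemma ext_eq0 P : projective P -> (forall z : ext P, z = 0) ->
  forall x, lspan (@jac_gen A P) x.
Proof.
move=> /dual_basis[c hc] h x; have [g hg] := ext_coord phi c.
rewrite -[x]hc /fev /=; apply: submodule_sum => [|t _]; first exact: lspan_submodule.
apply: sub_lspan; exists (fcoef (c x) t), t; split=> //; apply: hker.
by rewrite /= -[phi _]mul1r -hg (h (etens _ _ _)) linear0.
Qed.

Variables (DA : lmodType A -> Prop) (DB : lmodType B -> Prop).
Hypothesis cover : forall M, DA M -> has_cover DA M.
Hypothesis extD : forall M, DA M -> DB (ext M).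
Hypothesis nakA : forall M, DA M -> nakayama M.
Hypothesis nakB : forall N : lmodType B, DB N -> nakayama N.

Variables (d : nat) (hd : cdle (@flat A) d (right_restriction phi)).
Variables (M K0 : lmodType A) (hK0 : syz DA M d K0).

Lemma ext_inj n N K P (i : {linear K -> P}) (p : {linear P -> N}) :
  syz DA K0 n N -> ses i p -> forall z, ext_map i z = 0 -> z = 0.
Proof.
move=> hN S z; rewrite ext_mapE.
exact: (tor_syz hd (leq_addr n d) (syz_trans hK0 hN) S).
Qed.

Lemma ext_syz_down b n K : pdle b (ext K0) -> syz DA K0 n K -> pdle (b - n) (ext K).
Proof.
move=> hb; elim: n K => [|n IH] K; first by move=> [_ <-]; rewrite subn0.
move=> [N [P [i [p [hN S hP _ _]]]]]; rewrite subnS.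
exact: (pdle_syzygy (ext_ses S (ext_inj hN S)) (ext_projective hP) (IH _ hN)).
Qed.

Lemma ext_syz_up m n K : syz DA K0 n K -> pdle m (ext K) -> pdle (m + n) (ext K0).
Proof.
elim: n m K => [|n IH] m K; first by move=> [_ <-]; rewrite addn0.
move=> [N [P [i [p [hN S hP _ _]]]]] hK; rewrite addnS -addSn; apply: (IH _ _ hN).
exact: ext_pdle_ses S hP (ext_inj hN S) hK.
Qed.

(** The [m]-th syzygy of [K0] is the [(d + m)]-th of [M], hence projective, and stays so over [B].
    This admits [ext K0] to the supremum defining the finitistic dimension of [B]. *)
Lemma ext_syz_finite m : pdle m M -> pdle m (ext K0).
Proof.
move=> hm; have [K hK] := syz_ex m cover (syz_D hK0).
have hKp : pdle 0 K.
  by have := syz_pdle_down (syz_trans hK0 hK) hm; rewrite addnC subnDA subnn.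
exact: (ext_syz_up (m := 0) hK (ext_projective hKp)).
Qed.

Lemma pdle_ext b : pdle b (ext K0) -> pdle (b + d) M.
Proof.
move=> hb; have [Kb hKb] := syz_ex b cover (syz_D hK0).
have hP0 : projective (ext Kb) by have := ext_syz_down hb hKb; rewrite subnn.
have [K1 [P [i [p [S hP iJ DP DK1]]]]] := cover (syz_D hKb).
have ext_rad_eq0 N : DA N -> (forall z : ext N, lspan (@jac_gen B (ext N)) z) ->
    forall z : ext N, z = 0.
  by move=> /extD/nakB; apply: nakayama0.
(* [ext K1] is a direct summand of [ext P] contained in its radical. *)
have K1z : forall z : ext K1, z = 0.
  have [s [r [_ ri _]]] := ses_split (ext_ses S (ext_inj hKb S)) hP0.
  apply: ext_rad_eq0 => // z; rewrite -[z]ri; apply: jac_gen_linear.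
  exact: ext_radical.
have K1z' : forall x : K1, x = 0.
  (* [ext_eq0] needs a projective module, so the cover [Q] of [K1] is used. Right exactness makes
     [ext K2] surject onto [ext Q], with image in the radical. *)
  have [K2 [Q [i' [p' [S' hQ iJ' DQ DK2]]]]] := cover DK1.
  have Qz : forall z : ext Q, z = 0.
    apply: ext_rad_eq0 => // z.
    have [|w <-] := tmap_exact_r S' (z := z); last by rewrite -ext_mapE; apply: ext_radical.
    by rewrite -ext_mapE; apply: K1z.
  have Qz' := nakayama0 (nakA DQ) (ext_eq0 hQ Qz).
  by have [_ sp' _] := S' => x; have [y <-] := sp' x; rewrite (Qz' y) linear0.
have hKbp : pdle 0 Kb.
  have [_ sp ex] := S; apply: (pdle_iso (n := 0) (f := p)) => //.
  by apply: linear_injP => x /ex[k <-]; rewrite (K1z' k) linear0.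
by have := syz_pdle_up (syz_trans hK0 hKb) hKbp; rewrite add0n addnC.
Qed.
End Core.

(** * Auslander's theorem on the global dimension *)

Section Filtration.
Variable R : pzRingType.
Implicit Types M N L P K Q X Y : lmodType R.

Definition adjoin M (U : set M) (x : M) : set M := [set y | exists r : R, U (y - r *: x)].

Lemma adjoin_submodule M (U : set M) x : submodule U -> submodule (adjoin U x).
Proof.
move=> hU; split=> [|a y z [r hr] [s hs]].
  by exists 0; rewrite scale0r subr0; case: hU.
by exists (a * r + s); rewrite scalerDl -scalerA opprD addrACA -scalerBr; apply: hU.2.
Qed.

Lemma sub_adjoin M (U : set M) x : U `<=` adjoin U x.
Proof. by move=> y Uy; exists 0; rewrite scale0r subr0. Qed.

(* [Q] is isomorphic to [W / V]. *)
Definition is_quot N (W V : set N) Q : Prop :=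
  exists L (i : {linear L -> N}) (pi : {linear L -> Q}),
    [/\ injective i, forall y, W y <-> exists l, i l = y,
        forall q, exists l, pi l = q & forall l, pi l = 0 <-> V (i l)].

Section PartialLift.
Variables (L X Y : lmodType R) (g : {linear X -> Y}) (f : {linear L -> Y}).
Hypothesis sg : forall y, exists x, g x = y.

(** [h] is a total function of which only the values on [V] count; lifts with different domains thus
    share one type. *)
Definition partial_lift (V : set L) (h : L -> X) : Prop :=
  (forall a x y, V x -> V y -> h (a *: x + y) = a *: h x + h y) /\
  (forall x, V x -> g (h x) = f x).

(** As [W / V] is projective, [W] is [V] plus a copy of [Q]: [h] is kept on the first summand and
    [f] is lifted anew on the second. *)
Lemma partial_lift_extend (W V : set L) Q h : V `<=` W -> submodule V ->
  is_quot W V Q -> projective Q -> partial_lift V h ->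
  exists h', partial_lift W h' /\ forall l, V l -> h' l = h l.
Proof.
move=> VW hV [L' [i [pi [ii hi spi hpi]]]] hQ [hl hg].
have V0 : V 0 by case: hV.
have h0 : h 0 = 0 by have := hl (-1) 0 0 V0 V0; rewrite !scaleN1r addNr addNr.
have [s hs] := hQ _ _ pi idfun spi.
have [k hk] := hQ _ _ g (f \o i \o s) sg.
have /choice[inv hinv] : forall l, exists l', W l -> i l' = l.
  move=> l; have [/hi[l' <-]|nW] := pselect (W l); first by exists l'.
  by exists 0.
have Vres l' : V (i (l' - s (pi l'))) by apply/hpi; rewrite linearB /= hs subrr.
pose h' l := h (i (inv l - s (pi (inv l)))) + k (pi (inv l)).
exists h'; split; first split.
- move=> a x y Wx Wy; rewrite /h'.
  have -> : inv (a *: x + y) = a *: inv x + inv y.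
    apply: ii; rewrite linearP !hinv //.
    have [l <-] := (hi x).1 Wx; have [l' <-] := (hi y).1 Wy.
    by apply/hi; exists (a *: l + l'); rewrite linearP.
  set u := inv x; set v := inv y.
  have -> : a *: u + v - s (pi (a *: u + v)) =
      a *: (u - s (pi u)) + (v - s (pi v)).
    by rewrite (linearP pi) (linearP s) opprD addrACA scalerBr.
  by rewrite linearP hl // !linearP scalerDr addrACA.
- move=> x Wx; rewrite /h' (linearD g) hg // hk /= -linearD -linearD subrK hinv //.
move=> l Vl; have Wl := VW _ Vl; rewrite /h'.
have -> : pi (inv l) = 0 by apply/hpi; rewrite hinv.
by rewrite (linear0 s) (linear0 k) addr0 subr0 hinv.
Qed.
End PartialLift.

Section Continuous.
Variables (M N : lmodType R) (Phi : set M -> set N).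

(** A filtration of [N] indexed by the submodules of [M]. Separating [M] from [N] lets an induction
    pass to syzygies, which live in another module, with the index unchanged. *)
Definition continuous_family : Prop :=
  [/\ forall U, submodule U -> submodule (Phi U),
      forall U V, U `<=` V -> Phi U `<=` Phi V,
      forall F : set (set M), F !=set0 -> total_on F subset ->
        Phi (\bigcup_(U in F) U) `<=` \bigcup_(U in F) Phi U &
      Phi [set 0] `<=` [set 0]].
End Continuous.

Lemma chain_bigcup_submodule M (F : set (set M)) : F !=set0 -> total_on F subset ->
  (forall U, F U -> submodule U) -> submodule (\bigcup_(U in F) U).
Proof.
move=> [U0 FU0] Ftot hF; split; first by exists U0 => //; case: (hF _ FU0).
move=> a x y [U FU Ux] [V FV Vy].
have [UV|VU] := Ftot _ _ FU FV.
  by exists V => //; apply: (hF _ FV).2 => //; apply: UV.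
by exists U => //; apply: (hF _ FU).2 => //; apply: VU.
Qed.

(* Zorn's lemma on lifts defined on the members of the family. *)
Lemma filtered_projective M L (Psi : set M -> set L) :
  continuous_family Psi -> Psi setT = setT ->
  (forall U x, submodule U -> exists Q, is_quot (Psi (adjoin U x)) (Psi U) Q /\ projective Q) ->
  projective L.
Proof.
move=> [Psub Pmono Pcont P0] PT hQ X Y g f sg.
pose good (p : set M * (L -> X)) := submodule p.1 /\ partial_lift g f (Psi p.1) p.2.
pose T := {p | good p}.
pose le (p q : T) : bool := `[< (sval p).1 `<=` (sval q).1 /\
  forall l, Psi (sval p).1 l -> (sval p).2 l = (sval q).2 l >].
have g0 : good ([set 0], fun=> 0).
  split; first exact: submodule_set0.
  split=> [a x y _ _|x /P0 ->]; first by rewrite scaler0 addr0.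
  by rewrite !linear0.
have [||F Ftot|[[U h] [/= hU hh]] hmax] := @ZL_preorder T (exist _ _ g0) le.
- by move=> p; apply/asboolP; split.
- move=> q p r /asboolP[h1 h2] /asboolP[h3 h4]; apply/asboolP; split.
    by move=> x /h1/h3.
  by move=> l hl; rewrite h2 // h4 //; apply: (Pmono _ _ h1).
- have [[p0 Fp0]|Fe] := pselect (exists p, F p); last first.
    by exists (exist _ _ g0) => p Fp; case: Fe; exists p.
  pose G := [set (sval p).1 | p in F].
  have Gtot : total_on G subset.
    move=> _ _ [p Fp <-] [q Fq <-].
    by have [/asboolP[]|/asboolP[]] := Ftot _ _ Fp Fq; [left | right].
  have Gne : G !=set0 by exists (sval p0).1; exists p0.
  pose U := \bigcup_(V in G) V.
  have agree p q l : F p -> F q -> Psi (sval p).1 l -> Psi (sval q).1 l ->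
      (sval p).2 l = (sval q).2 l.
    move=> Fp Fq hp hq; have [/asboolP[_ ->]|/asboolP[_ ->]] := Ftot _ _ Fp Fq => //.
  have /choice[h hh] : forall l, exists x, forall p, F p -> Psi (sval p).1 l -> x = (sval p).2 l.
    move=> l; have [[p [Fp hp]]|np] := pselect (exists p, F p /\ Psi (sval p).1 l).
      by exists ((sval p).2 l) => q Fq hq; apply: agree.
    by exists 0 => p Fp hp; case: np; exists p.
  have cover l : Psi U l -> exists2 p, F p & Psi (sval p).1 l.
    by move=> /(Pcont _ Gne Gtot)[_ [p Fp <-] hl]; exists p.
  have gU : good (U, h).
    split=> /=.
      apply: chain_bigcup_submodule => // _ [p Fp <-]; exact: (svalP p).1.
    split=> [a x y /cover[p Fp hp] /cover[q Fq hq]|x /cover[p Fp hp]]; last first.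
      by rewrite (hh _ p) //; apply: (svalP p).2.2.
    have [r [Fr hx hy]] : exists r, [/\ F r, Psi (sval r).1 x & Psi (sval r).1 y].
      have [/asboolP[pq _]|/asboolP[qp _]] := Ftot _ _ Fp Fq.
        by exists q; split=> //; exact: Pmono hp.
      by exists p; split=> //; exact: Pmono hq.
    rewrite !(hh _ r) //; first exact: (svalP r).2.1.
    by apply: (Psub _ (svalP r).1).2.
  exists (exist _ _ gU) => p Fp; apply/asboolP; split=> [x hx|l hl] /=.
    by exists (sval p).1 => //; exists p.
  by rewrite (hh l p).
(* Otherwise the lift would extend to the step indexed by [adjoin U x], against maximality. *)
have UT : U = setT.
  rewrite predeqE => x; split=> // _.
  have [Q [hq hQp]] := hQ U x hU.
  have [h' [hh' h'h]] := partial_lift_extend sg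
    (Pmono _ _ (@sub_adjoin _ U x)) (Psub _ hU) hq hQp hh.
  have g' : good (adjoin U x, h') by split=> //; exact: adjoin_submodule.
  have /asboolP[/= + _] := hmax (exist _ _ g')
    (asboolT (conj (@sub_adjoin _ U x) (fun l hl => esym (h'h l hl)))).
  by apply; exists 1; rewrite scale1r subrr; have [] := hU.
have [hl hgf] := hh; rewrite UT PT in hl hgf.
have [k hk] : exists k : {linear L -> X}, forall x, k x = h x.
  by apply: linear_ex => a x y; apply: hl.
by exists k => x; rewrite hk hgf.
Qed.

Section Relations.
Variable N : lmodType R.

(* A functorial first syzygy of [W]; leaving out the generator [0] makes
   [relations [set 0]] vanish. *)
Definition relations (W : set N) : set (free_mod R N) :=
  [set z | (forall t, ~ (W t /\ t <> 0) -> fcoef z t = 0) /\ fev id z = 0].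

Lemma relations_submodule W : submodule (relations W).
Proof.
split=> [|a z w [hz ez] [hw ew]]; first by split=> //; rewrite linear0.
split=> [t ht|]; first by rewrite fcoefD fcoefZ hz // hw // mulr0 addr0.
by rewrite linearP /= ez ew scaler0 addr0.
Qed.

Lemma relations_mono W V : V `<=` W -> relations V `<=` relations W.
Proof.
move=> VW z [hz ez]; split=> // t ht; apply: hz => -[Vt t0].
by apply: ht; split=> //; apply: VW.
Qed.

(** The free module on the elements of [W] outside [V] covers [Q]. Restricting coefficients to these
    elements sends relations of [W] onto the kernel, and what it kills is the relations of [V]. *)
Lemma quot_relations (W V : set N) Q : submodule W -> submodule V -> V `<=` W ->
  is_quot W V Q ->
  exists K P (k : {linear K -> P}) (q : {linear P -> Q}),
    [/\ ses k q, projective P & is_quot (relations W) (relations V) K].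
Proof.
move=> hW hV VW [L [i [pi [ii hi spi hpi]]]].
have V0 : V 0 by case: hV.
have /choice[inv hinv] : forall t, exists l, W t -> i l = t.
  move=> l; have [/hi[l' <-]|nW] := pselect (W l); first by exists l'.
  by exists 0.
pose e (t : N) : R := if pselect (W t /\ ~ V t) then 1 else 0.
have e1 t : W t -> ~ V t -> e t = 1 by move=> Wt nV; rewrite /e; case: pselect => // h; case: h.
have e0 t : ~ (W t /\ ~ V t) -> e t = 0 by rewrite /e; case: pselect.
have he t : e t * e t = e t.
  by rewrite /e; case: pselect => ?; rewrite ?mulr1 ?mulr0.
have [P [j [ij hj]]] := submodule_ex (idem_free_submodule e).
have hP : projective P by exact: idem_free_projective he _ _ ij hj.
have jP v t : ~ (W t /\ ~ V t) -> fcoef (j v) t = 0.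
  by have /hj h : exists v', j v' = j v by [exists v]; move=> nt; rewrite -h e0 // mulr0.
have jex z : (forall t, ~ (W t /\ ~ V t) -> fcoef z t = 0) -> exists v, j v = z.
  move=> hz; apply/hj => t; have [[Wt Vt]|nt] := pselect (W t /\ ~ V t).
    by rewrite e1 // mulr1.
  by rewrite hz // mul0r.
pose q : {linear P -> Q} := fev (pi \o inv) \o j.
have sq y : exists v, q v = y.
  have [l <-] := spi y.
  have [Vl|nVl] := pselect (V (i l)); first by exists 0; rewrite linear0; apply/esym/hpi.
  have Wl : W (i l) by apply/hi; exists l.
  have [|v hv] := jex (fdelta (i l) 1).
    by move=> t ht; rewrite fdeltaE; case: eqP => // tl; case: ht; rewrite tl.
  exists v; rewrite /= hv fev_delta scale1r /=; congr (pi _).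
  by apply: ii; apply: hinv.
have [K [k S]] := ses_kernel sq; have [ik _ ex] := S.
exists K, P, k, q; split=> //.
have ev_inv z : (forall t, ~ W t -> fcoef z t = 0) -> i (fev inv z) = fev id z.
  move=> hz; have [s hs] := fcoefP z.
  rewrite /= /fev !(lincombE _ hs) linear_sum; apply: eq_bigr => t _.
  rewrite linearZ /=; have [Wt|nW] := pselect (W t); first by rewrite hinv.
  by rewrite hz // !scale0r.
have ev_pi z : fev (pi \o inv) z = pi (fev inv z).
  have [s hs] := fcoefP z.
  rewrite /= /fev !(lincombE _ hs) linear_sum; apply: eq_bigr => t _.
  by rewrite linearZ.
have [L' [i' [ii' hi']]] := submodule_ex (relations_submodule W).
have iL' l : relations W (i' l) by apply/hi'; exists l.
pose rho : {linear free_mod R N -> free_mod R N} := fev (fun t => fdelta t (e t)).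
have rhoE z t : fcoef (rho z) t = fcoef z t * e t.
  have [s [us hs]] := fcoefP z.
  have -> : rho z = \sum_(u <- s) fdelta u (fcoef z u * e u).
    rewrite /rho /= /fev (lincombE _ (conj us hs)); apply: eq_bigr => u _.
    by rewrite fdeltaZ.
  have [w hw] : exists w : free_mod R N, forall u, fcoef w u = fcoef z u * e u.
    by apply: free_mod_ex; exists s; split=> // u /hs->; rewrite mul0r.
  rewrite -hw; congr (fcoef _ t); rewrite [RHS](free_sum (s := s)).
    by apply: eq_bigr => u _; rewrite hw.
  by split=> // u /hs; rewrite hw => ->; rewrite mul0r.
have rho_supp z s : supp_in (fcoef z) s -> supp_in (fcoef (rho z)) s.
  by move=> [us hs]; split=> // t /hs h; rewrite rhoE h mul0r.
have ev_rho z : (forall t, ~ W t -> fcoef z t = 0) ->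
    fev (pi \o inv) (rho z) = fev (pi \o inv) z.
  move=> hz; have [s hs] := fcoefP z.
  rewrite /= /fev (lincombE _ (rho_supp _ _ hs)) (lincombE _ hs).
  apply: eq_bigr => t _; rewrite rhoE /=.
  have [Wt|nW] := pselect (W t); last by rewrite hz // mul0r !scale0r.
  have [Vt|nV] := pselect (V t); last by rewrite e1 // mulr1.
  by have -> : pi (inv t) = 0; [apply/hpi; rewrite hinv | rewrite !scaler0].
have [|a ha] := @factor_inj _ _ _ _ j (rho \o i') ij.
  by move=> l; apply: jex => t nt; rewrite rhoE e0 // mulr0.
have iW l t : ~ W t -> fcoef (i' l) t = 0.
  by move=> nW; apply: (iL' l).1 => -[].
have [|b hb] := @factor_inj _ _ _ _ k a ik.
  move=> l; apply/ex; rewrite /q /= ha /= ev_rho; last exact: iW.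
  rewrite ev_pi; have -> : fev inv (i' l) = 0; last exact: linear0.
  by apply: ii; rewrite ev_inv ?linear0; [exact: (iL' l).2 | exact: iW].
exists L', i', b; split=> // [kappa|l].
  (* [w] evaluates to some [y] in [V]. Subtracting the symbol of [y], which [rho] forgets, turns [w]
     into a relation; for [y = 0] the correction is 0, as the symbol of 0 is excluded. *)
  pose w := j (k kappa); pose y := fev id w.
  have wW t : ~ W t -> fcoef w t = 0 by move=> nW; apply: jP => -[].
  have Vy : V y.
    rewrite /y -ev_inv //; apply/hpi; rewrite -ev_pi.
    exact: (ses_comp0 kappa S).
  have [dl [dl1 dl2]] : exists dl : free_mod R N, fev id dl = y /\
      forall t, ~ (V t /\ t <> 0) -> fcoef dl t = 0.
    have [y0|ny] := pselect (y = 0); first by exists 0; rewrite linear0 y0.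
    exists (fdelta y 1); rewrite fev_delta scale1r; split=> // t ht.
    by rewrite fdeltaE; case: eqP => // ty; case: ht; rewrite ty.
  have /hi'[l hl] : relations W (w - dl).
    split; last by rewrite linearB /= dl1 subrr.
    move=> t ht; rewrite fcoefB dl2 ?subr0; last first.
      by move=> [Vt t0]; apply: ht; split=> //; apply: VW.
    by apply: jP => -[Wt nV]; apply: ht; split=> // t0; apply: nV; rewrite t0.
  exists l; apply: ik; apply: ij; rewrite hb ha /= hl.
  apply: fcoef_inj => t; rewrite rhoE fcoefB.
  have [[Wt nV]|nt] := pselect (W t /\ ~ V t); last by rewrite e0 // mulr0 jP.
  by rewrite e1 // mulr1 dl2 ?subr0 // => -[].
have bl0 : b l = 0 <-> rho (i' l) = 0.
  rewrite -[rho _]/((rho \o i') l) -ha -hb; split=> [->|]; first by rewrite !linear0.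
  by rewrite -{1}(linear0 j) => /ij; rewrite -{1}(linear0 k) => /ik.
rewrite bl0; split=> [h|[h1 h2]].
  split; last exact: (iL' l).2.
  move=> t ht; have [[Wt nV]|nt] := pselect (W t /\ ~ V t).
    by rewrite -[fcoef _ t]mulr1 -(e1 t) // -rhoE h.
  apply: (iL' l).1 => -[Wt t0]; apply: nt; split=> // Vt; exact: ht.
apply: fcoef_inj => t; rewrite rhoE fcoef0.
have [[Wt nV]|nt] := pselect (W t /\ ~ V t); last by rewrite e0 // mulr0.
by rewrite h1 ?mul0r // => -[].
Qed.

End Relations.

(** Induction on [n], replacing [Phi] by the relations of [Phi]: the new total module is a syzygy of
    [L] and the new successive quotients are syzygies of the old ones. *)
Lemma filtered_pdle n M N L (Phi : set M -> set N) (j : {linear L -> N}) :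
  continuous_family Phi ->
  (forall U x, submodule U -> exists Q, is_quot (Phi (adjoin U x)) (Phi U) Q /\ pdle n Q) ->
  injective j -> (forall y, Phi setT y <-> exists l, j l = y) -> pdle n L.
Proof.
elim: n N L Phi j => [|n IH] N L Phi j [Psub Pmono Pcont P0] hQ ij hj.
  apply: (@filtered_projective M L (fun U => [set l | Phi U (j l)])).
  - split=> [U hU|U V UV l|F Fne Ftot l|l] /=.
    + split=> [|a x y hx hy] /=; first by rewrite linear0; case: (Psub _ hU).
      by rewrite linearP; apply: (Psub _ hU).2.
    + exact: Pmono.
    + by move=> /(Pcont _ Fne Ftot)[U FU h]; exists U.
    + by move=> /P0 h; apply: ij; rewrite h linear0.
  - by rewrite predeqE => l; split=> // _; apply/hj; exists l.
  move=> U x hU; have [Q [[L' [i [pi [ii hi spi hpi]]]] hQp]] := hQ U x hU.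
  exists Q; split=> //; have [|i' hi'] := @factor_inj _ _ _ _ j i ij.
    move=> l; apply/hj; apply: (Pmono (adjoin U x)) => //.
    by apply/hi; exists l.
  exists L', i', pi; split=> // [u v e|y|l].
  - by apply: ii; rewrite -!hi' e.
  - rewrite /= hi; split=> [[l hl]|[l <-]]; last by exists l; rewrite hi'.
    by exists l; apply: ij; rewrite hi'.
  - by rewrite /= hi'.
have ji y : Phi setT (j y) by apply/hj; exists y.
have [K [P [k [q [S hP [L' [i' [pi' [ii' hi' spi' hpi']]]]]]]]] :
    exists K P (k : {linear K -> P}) (q : {linear P -> L}),
    [/\ ses k q, projective P & is_quot (relations (Phi setT)) (relations [set 0]) K].
  apply: quot_relations => [||_ ->|].
  - exact: Psub.
  - exact: submodule_set0.
  - by rewrite -(linear0 j).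
  exists L, j, idfun; split=> // [y|l]; first by exists y.
  by split=> [/= ->|/=]; [rewrite linear0 | rewrite -{1}(linear0 j) => /ij].
exists K, P, k, q; split=> //.
have {}hpi' l : pi' l = 0 -> l = 0.
  move=> /hpi'[h _]; apply: ii'; rewrite linear0; apply: fcoef_inj => t.
  by rewrite h ?fcoef0 // => -[].
apply: (pdle_iso (linear_injP hpi') spi').
apply: (IH _ L' (fun U => relations (Phi U)) i' _ _ ii' hi').
- split=> [U _|U V UV|F [U0 FU0] Ftot z [hz ez]|z [hz _]].
  + exact: relations_submodule.
  + by apply: relations_mono; apply: Pmono.
  (* Continuity comes from finite support: the finitely many elements involved in a relation all lie
     in one member of the chain. *)
  + have [s [us hs]] := fcoefP z.
    pose s' := [seq t <- s | fcoef z t != 0].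
    have zs' t : t \notin s' -> fcoef z t = 0.
      rewrite mem_filter negb_and negbK => /orP[/eqP//|]; exact: hs.
    have Pne : Phi @` F !=set0 by exists (Phi U0); exists U0.
    have [||s'0|[_ [U FU <-] hU]] := @chain_seq _ (Phi @` F) s'.
    * move=> _ _ [U FU <-] [V FV <-].
      by have [UV|VU] := Ftot _ _ FU FV; [left | right]; apply: Pmono.
    * move=> t; rewrite mem_filter => /andP[/eqP zt _].
      have [//|ht] := pselect (exists2 B, (Phi @` F) B & B t).
      case: zt; apply: hz => -[ht' _]; apply: ht.
      have [|U FU Ut] := Pcont F _ Ftot t ht'; first by exists U0.
      by exists (Phi U) => //; exists U.
    * by exists U0 => //; split=> // t _; apply: zs'; rewrite s'0.
    * exists U => //; split=> // t ht; apply: zs'; apply: contra_notN ht => ts'.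
      split; first exact: hU.
      move=> t0; move: ts'; rewrite mem_filter => /andP[/eqP zt _]; apply: zt.
      by apply: hz => -[].
  + apply: fcoef_inj => t; rewrite fcoef0; apply: hz => -[/P0 /= t0]; exact.
- move=> U x hU; have [Q [hq hQn]] := hQ U x hU.
  have [K' [P' [k' [q' [S' hP' hq']]]]] := quot_relations
    (Psub _ (adjoin_submodule x hU)) (Psub _ hU) (Pmono _ _ (@sub_adjoin _ U x)) hq.
  by exists K'; split=> //; exact: (pdle_syzygy S' hP' hQn).
Qed.

(** For the identity family the successive quotients [(U + R x) / U] are cyclic, so they fall under
    the hypothesis. *)
Lemma auslander n : (forall M, finitely_generated M -> pdle n M) -> forall M, pdle n M.
Proof.
move=> h M; apply: (@filtered_pdle n M M M id idfun) => //.
- by split=> [//|//|F _ _ x|x].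
- move=> U x hU; have hU' := adjoin_submodule x hU.
  have [L [i [ii hi]]] := submodule_ex hU'.
  have hV : submodule [set l | U (i l)].
    split=> [|a u v hu hv] /=; first by rewrite linear0; case: hU.
    by rewrite linearP; apply: hU.2.
  have [Q [pi [spi hpi]]] := quotient_ex hV.
  exists Q; split; first by exists L, i, pi.
  apply: h; have [l0 hl0] : exists l, i l = x.
    by apply/hi; exists 1; rewrite scale1r subrr; case: hU.
  exists [:: pi l0] => y; have [l <-] := spi y.
  have [r hr] : adjoin U x (i l) by apply/hi; exists l.
  exists (fun=> r); rewrite big_ord1 /= -linearZ; apply/eqP.
  rewrite -subr_eq0 -linearB; apply/eqP/hpi.
  by rewrite /= linearB linearZ /= hl0.
- by move=> y; split=> // _; exists y.
Qed.

End Filtration.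

(** * The dimension bounds *)

Lemma ext_finitely_generated (A B : pzRingType) (phi : {rmorphism A -> B}) (M : lmodType A) :
  finitely_generated M -> finitely_generated (ext phi M).
Proof.
move=> /finitely_generatedP[s hs]; apply/finitely_generatedP.
exists (map (etens phi 1) s); set G := lspan _.
have [G0 GD GZ GB] := submodule_lin (lspan_submodule [set` map (etens phi 1) s]).
apply: ext_ind => [b n|x y]; last exact: GB.
move: (hs n) b; apply: (lspan_min (U := [set n | forall b, G (etens phi b n)])) => [|m ms b].
  split=> [b|a u v hu hv b]; first by rewrite etens0.
  by rewrite etensDr -etens_bal; exact: (GD _ _ (hu _) (hv _)).
by rewrite -[b]mulr1 -etensZ; apply: GZ; apply: sub_lspan; exact: map_f.
Qed.

Lemma zero_module_ex (R : pzRingType) : exists M : lmodType R, forall x : M, x = 0.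
Proof.
have [M [i [ii hi]]] := submodule_ex (@submodule_set0 R R^o).
exists M => x; apply: ii; rewrite linear0.
by have /hi : exists y, i y = i x by exists x.
Qed.

Section Bounds.
Variables (A B : pzRingType) (phi : {rmorphism A -> B}).
Hypotheses (hrad : radical_preserving phi) (hker : superfluous_kernel phi).
Variables (DA : lmodType A -> Prop) (DB : lmodType B -> Prop).
Hypothesis cover : forall M, DA M -> has_cover DA M.
Hypothesis extD : forall M, DA M -> DB (ext phi M).
Hypothesis nakA : forall M, DA M -> nakayama M.
Hypothesis nakB : forall N : lmodType B, DB N -> nakayama N.
Hypothesis DB0 : forall N : lmodType B, (forall x : N, x = 0) -> DB N.

Lemma sup_pd_finite_le :
  (sup_pd (fun M => DA M /\ proj_dim M < +oo) <=
   sup_pd (fun N => DB N /\ proj_dim N < +oo) + flat_dim (right_restriction phi))%E.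
Proof.
apply: sup_pd_add_le => [|b d hd hN M [DM /proj_dim_fin[m hm]]].
  have [Z hZ] := zero_module_ex B; exists Z; split; first exact: DB0.
  by apply/proj_dim_fin; exists 0%N; exact: projective_zero.
have {}hd := has_resolution_cdle hd; have [K hK] := syz_ex d cover DM.
apply: (pdle_ext hrad hker cover extD nakA nakB hd hK); apply: hN.
split; first exact: extD (syz_D hK).
by apply/proj_dim_fin; exists m; exact: (ext_syz_finite cover hd hK hm).
Qed.

(** The premise is Auslander's theorem when [DA] is finite generation, and immediate when [DA] holds
    of all modules. *)
Lemma gl_dim_le :
  (forall n, (forall M, DA M -> pdle n M) -> forall M : lmodType A, pdle n M) ->
  (gl_dim A <= gl_dim B + flat_dim (right_restriction phi))%E.
Proof.
move=> hall; rewrite !gl_dimE; apply: sup_pd_add_le => [|b d hd hN M _].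
  by have [Z _] := zero_module_ex B; exists Z.
have {}hd := has_resolution_cdle hd; apply: hall M => M DM.
have [K hK] := syz_ex d cover DM.
by apply: (pdle_ext hrad hker cover extD nakA nakB hd hK); apply: hN.
Qed.
End Bounds.

Local Open Scope ereal_scope.

Theorem theorem3p11 (A B : pzRingType) (phi : {rmorphism A -> B})
    (hrad : radical_preserving phi) (hker : superfluous_kernel phi) :
  (left_noetherian A -> semiperfect A ->
     (fin_dim A <= fin_dim B + flat_dim (right_restriction phi)) /\
     (gl_dim A <= gl_dim B + flat_dim (right_restriction phi))) /\
  (left_perfect A -> left_T_nilpotent (@jacobson B) ->
     (Fin_dim A <= Fin_dim B + flat_dim (right_restriction phi)) /\
     (gl_dim A <= gl_dim B + flat_dim (right_restriction phi))).
Proof.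
split=> [hN hS|hP hT].
  have cov M : finitely_generated M -> has_cover (@finitely_generated A) M.
    exact: noetherian_cover.
  have extf := @ext_finitely_generated A B phi.
  have nA := @finitely_generated_nakayama A.
  have nB := @finitely_generated_nakayama B.
  have gl := gl_dim_le hrad hker cov extf nA nB.
  split; first last; first exact: gl (@auslander A).
  rewrite !fin_dimE; apply: (sup_pd_finite_le hrad hker cov extf nA nB) => N hN0.
  by exists [::] => x; exists (fun=> 0%R); rewrite big_ord0.
(* The class is now that of all modules, and T-nilpotence of the two radicals gives Nakayama on each
   side. *)
have cov M : True -> has_cover (fun _ : lmodType A => True) M.
  by move=> _; exact: perfect_cover.
have nA M : True -> @nakayama A M by move=> _; apply: T_nilpotent_nakayama; case: hP.
have nB N : True -> @nakayama B N by move=> _; apply: T_nilpotent_nakayama.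
have extT (M : lmodType A) : True -> (fun _ : lmodType B => True) (ext phi M) by [].
split; last by apply: (gl_dim_le hrad hker cov extT nA nB) => n h M; exact: h.
have Fin_dimE (R : pzRingType) :
    Fin_dim R = sup_pd (fun M : lmodType R => True /\ proj_dim M < +oo).
  congr supremum; rewrite predeqE => d.
  by split=> [[M [h ->]]|[M [[_ h] ->]]]; exists M.
by rewrite !Fin_dimE; exact: (sup_pd_finite_le hrad hker cov extT nA nB).
Qed.
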